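(* Let $m$ be a positive integer, let $1\le k\le m$, and let $\mathcal{I}=\{I_1,\ldots,I_k\}$ be a family of pairwise disjoint non-void subsets of $\{1,\ldots,m\}$ such that $\bigcup_{j=1}^k I_j=\{1,\ldots,m\}$. Let $n=\min\{|I_1|,\ldots,|I_k|\}$ and let $1\le p\le\infty$. Then $$\mathcal{L}(^m\ell_1;\ell_p)=\mathcal{L}_{\mathcal{I},as(t;1)}(^m\ell_1;\ell_p)$$ with $$t=\begin{cases}\dfrac{2p}{np+2p-2}, & \text{if } 1\le p\le 2,\\[2mm] \dfrac{2p}{np+2}, & \text{if } 2\le p\le\infty,\end{cases}$$ where for $p=\infty$ the value is read as $t=\frac{2}{n}$. Moreover, the parameter $t$ is optimal when $2\le p\le\infty$; that is, in that case, for every real $r$ with $0<r<t$ one has $\mathcal{L}(^m\ell_1;\ell_p)\ne\mathcal{L}_{\mathcal{I},as(r;1)}(^m\ell_1;\ell_p)$.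
   Context: All Banach spaces are over $\mathbb{K}=\mathbb{R}$ or $\mathbb{C}$. $\mathcal{L}(^mE;F)$ is the space of all bounded $m$-linear operators $E\times\cdots\times E\to F$. For a Banach space $E$ with closed dual unit ball $B_{E^*}$, $\ell_1^w(E)$ is the space of sequences $(x_j)_{j=1}^\infty$ in $E$ with $\sup_{\varphi\in B_{E^*}}\sum_{j=1}^\infty|\varphi(x_j)|<\infty$. For a partition $\mathcal{I}=\{I_1,\ldots,I_k\}$ of $\{1,\ldots,m\}$ into non-void sets, $\Omega_{\mathcal{I}}\subset\mathbb{N}^m$ is the product of diagonals $\mathrm{Diag}(\mathbb{N}^{|I_1|})\times\cdots\times\mathrm{Diag}(\mathbb{N}^{|I_k|})$, where the factor for $I_i$ occupies the coordinates indexed by $I_i$; that is, $\Omega_{\mathcal{I}}$ is the set of $(j_1,\ldots,j_m)\in\mathbb{N}^m$ with $j_a=j_b$ whenever $a,b$ belong to the same block $I_i$. For $r\in(0,\infty)$ and a Banach space $F$, $\mathcal{L}_{\mathcal{I},as(r;1)}(^m\ell_1;F)$ is the space of all $T\in\mathcal{L}(^m\ell_1;F)$ such that $\sum_{(j_1,\ldots,j_m)\in\Omega_{\mathcal{I}}}\|T(x^{(1)}_{j_1},\ldots,x^{(m)}_{j_m})\|_F^r<\infty$ whenever $(x^{(i)}_{j})_{j=1}^\infty\in\ell_1^w(\ell_1)$ for $i=1,\ldots,m$. *)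

(* Defs.v *)
From HB Require Import structures.
From mathcomp Require Import all_boot all_order all_algebra.
From mathcomp Require Import complex.
From mathcomp Require Import all_classical all_reals all_analysis.
From mathcomp Require Import ess_sup_inf.

Set Implicit Arguments.
Unset Strict Implicit.
Unset Printing Implicit Defensive.

Import Order.TTheory GRing.Theory Num.Theory.
Import numFieldNormedType.Exports.

Local Open Scope classical_set_scope.
Local Open Scope ring_scope.

Variant scalar_kind := RealScalars | ComplexScalars.

Definition scalars (R : realType) (s : scalar_kind) : numFieldType :=
  match s with
  | RealScalars => R
  | ComplexScalars => R[i]
  end.

Section RealScalarValues.
Context {R : realType} {s : scalar_kind}.

(* Norms of a [normedModType (scalars R s)] take values in [scalars R s]; they
   are real there, and [real_of] reads them back in [R]. *)
Definition real_of : scalars R s -> R :=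
  match s with
  | RealScalars => id
  | ComplexScalars => @complex.Re R
  end.

Definition of_real : R -> scalars R s :=
  match s with
  | RealScalars => id
  | ComplexScalars => real_complex R
  end.

Definition rnorm {V : normedModType (scalars R s)} (x : V) : R := real_of `|x|.

End RealScalarValues.

Section RealScalarTheory.
Context {R : realType} {s : scalar_kind}.
Local Notation K := (scalars R s).

Lemma of_realK : cancel (@of_real R s) real_of.
Proof. by case: s. Qed.

Lemma real_ofK (z : K) : 0 <= z -> of_real (real_of z) = z.
Proof. by move: z; case: s => //= -[a b]; rewrite lecE/= => /andP[/eqP->]. Qed.

Lemma of_realD (a b : R) : of_real (a + b) = of_real a + of_real b :> K.
Proof. by case: s => //=; rewrite rmorphD. Qed.

Lemma of_realM (a b : R) : of_real (a * b) = of_real a * of_real b :> K.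
Proof. by case: s => //=; rewrite rmorphM. Qed.

Lemma of_real0 : of_real 0 = 0 :> K.
Proof. by case: s. Qed.

Lemma le_of_real (a b : R) : (of_real a <= of_real b :> K) = (a <= b).
Proof. by case: s => //=; rewrite lecR. Qed.

Lemma rnormK (V : normedModType K) (x : V) : of_real (rnorm x) = `|x|.
Proof. exact: real_ofK. Qed.

Lemma rnorm_ge0 (V : normedModType K) (x : V) : 0 <= rnorm x.
Proof. by rewrite -le_of_real of_real0 rnormK. Qed.

Lemma rnormD (V : normedModType K) (x y : V) :
  rnorm (x + y) <= rnorm x + rnorm y.
Proof. by rewrite -le_of_real of_realD !rnormK ler_normD. Qed.

Lemma rnormZ (V : normedModType K) (a : K^o) (x : V) :
  rnorm (a *: x) = rnorm a * rnorm x.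
Proof. by apply: (can_inj of_realK); rewrite of_realM !rnormK normrZ. Qed.

Lemma rnorm0 (V : normedModType K) : rnorm (0 : V) = 0.
Proof. by apply: (can_inj of_realK); rewrite rnormK normr0 of_real0. Qed.

Lemma rnorm0_eq0 (V : normedModType K) (x : V) : rnorm x = 0 -> x = 0.
Proof. by move=> x0; apply: normr0_eq0; rewrite -rnormK x0 of_real0. Qed.

End RealScalarTheory.

Lemma ae_counting (R : realType) (P : nat -> Prop) :
  (\forall j \ae (@counting nat R), P j) -> forall j, P j.
Proof.
move=> [A [_ A0 PA]] j; apply: contrapT => /PA Aj.
move: A0; rewrite /= /counting; case: asboolP => // finA [] /eqP.
rewrite pnatr_eq0 finmap.cardfs_eq0 => /eqP A0.
by move: Aj; rewrite (fset_set_set0 finA A0).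
Qed.

Section EllSpace.
Context {R : realType} (s : scalar_kind).
Local Notation K := (scalars R s).

Definition ell_norm (p : \bar R) (x : nat -> K^o) : \bar R :=
  'N[counting]_p[EFin \o (fun j => rnorm (x j))]%E.

Definition in_ell (p : \bar R) : {pred nat -> K^o} :=
  fun x => (ell_norm p x < +oo)%E.

Lemma ell_norm_ge0 p x : (0 <= ell_norm p x)%E.
Proof. exact: Lnorm_ge0. Qed.

Lemma ell_norm_fin_expE (q : R) (x : nat -> K^o) : 0 < q ->
  ell_norm q%:E x =
  ((\sum_(0 <= j <oo) (rnorm (x j) `^ q)%:E) `^ q^-1)%E.
Proof.
move=> q0; rewrite /ell_norm Lnorm_counting//; congr (_ `^ _)%E.
by apply: eq_eseriesr => j _ /=; rewrite ger0_norm ?rnorm_ge0.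
Qed.

Lemma ell_norm_pinftyE (x : nat -> K^o) :
  ell_norm +oo%E x = ereal_sup (range (fun j => (rnorm (x j))%:E)).
Proof.
rewrite /ell_norm unlock /Lnorm ifT; last first.
  by rewrite /= /counting; case: asboolP => // /infinite_nat.
apply/eqP; rewrite eq_le; apply/andP; split.
  apply/ess_supP/nearW => j /=; rewrite ger0_norm ?rnorm_ge0//.
  by apply: ereal_sup_ubound; exists j.
apply: ge_ereal_sup => _ [j _ <-].
have /ae_counting/(_ j)/= :=
  ess_sup_ge counting (abse \o (EFin \o (fun j => rnorm (x j)))).
by rewrite ger0_norm ?rnorm_ge0.
Qed.

Section Closure.
Variables (p : \bar R) (p1 : (1 <= p)%E).
Implicit Types x y : nat -> K^o.

Let setT_gt0 : (0 < @counting nat R [set: nat])%E.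
Proof. by rewrite /counting; case: asboolP => // /infinite_nat. Qed.

Let le_counting (f g : nat -> R) : (forall j, 0 <= f j <= g j) ->
  ('N[counting]_p[EFin \o f] <= 'N[counting]_p[EFin \o g])%E.
Proof.
move=> fg; rewrite unlock /Lnorm; case: p p1 => // [r r1|_].
  rewrite lee_fin in r1; have r0 : 0 < r := lt_le_trans ltr01 r1.
  have le_pow j : ((`|(f j)%:E| `^ r)%E <= (`|(g j)%:E| `^ r)%E)%E.
    have /andP[f0 fgj] := fg j.
    rewrite lee_fin ge0_ler_powR ?nnegrE ?(ltW r0)//.
    by rewrite !ger0_norm// (le_trans f0).
  apply: gt0_ler_poweR; rewrite ?invr_ge0 ?(ltW r0)//.
  - by rewrite in_itv/= leey andbT integral_ge0// => j _; exact: poweR_ge0.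
  - by rewrite in_itv/= leey andbT integral_ge0// => j _; exact: poweR_ge0.
  by apply: ge0_le_integral => // j _; [exact: poweR_ge0|exact: le_pow].
rewrite !ifT ?setT_gt0 //; apply/le_ess_sup/nearW => j /=.
have /andP[f0 fgj] := fg j.
by rewrite lee_fin !ger0_norm// (le_trans f0).
Qed.

Lemma ell_normD x y : (ell_norm p (x + y)%R <= ell_norm p x + ell_norm p y)%E.
Proof.
apply: (@le_trans _ _ ('N[counting]_p[EFin \o
    ((fun j => rnorm (x j)) \+ (fun j => rnorm (y j)))%R])%E).
  by apply: le_counting => j; rewrite rnorm_ge0/= rnormD.
exact: eminkowski.
Qed.

Lemma ell_normZ (a : K) x :
  ell_norm p (a *: x) = ((rnorm (a : K^o))%:E * ell_norm p x)%E.
Proof.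
have -> : ell_norm p (a *: x) =
    ('N[counting]_p[EFin \o (fun j => rnorm (a : K^o) * rnorm (x j))%R])%E.
  by apply: eq_Lnorm => j /=; rewrite -rnormZ.
rewrite /ell_norm unlock /Lnorm; case: p p1 => // [r r1|_].
  rewrite lee_fin in r1; have r0 : 0 < r := lt_le_trans ltr01 r1.
  under eq_integral do rewrite /= normrM powRM// ger0_norm ?rnorm_ge0// EFinM.
  rewrite ge0_integralZl//; last by rewrite lee_fin powR_ge0.
  rewrite poweRM ?lee_fin ?powR_ge0//; last first.
    by apply: integral_ge0 => j _; rewrite lee_fin powR_ge0.
  by rewrite poweR_EFin -powRrM mulfV ?gt_eqF// powRr1 ?rnorm_ge0.
rewrite !ifT ?setT_gt0 // -ess_supZl ?rnorm_ge0//; apply/eq_ess_sup/nearW => j /=.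
by rewrite normrM EFinM ger0_norm ?rnorm_ge0.
Qed.

Lemma ell_norm_eq0 x : ell_norm p x = 0%E -> x = 0.
Proof.
move=> x0; apply/funext => j.
have xae := @Lnorm_eq0_eq0 _ nat R counting
  (EFin \o (fun j => rnorm (x j))) p (fun _ _ _ => I) (lt_le_trans lte01 p1) x0.
by have /(_ I)[/rnorm0_eq0] := ae_counting xae j.
Qed.

Lemma ell_norm0 : ell_norm p 0 = 0%E.
Proof. by rewrite -(scale0r 0) ell_normZ rnorm0 mul0e. Qed.

Lemma ell_submod_closed : submod_closed (in_ell p).
Proof.
split=> [|a x y]; rewrite !unfold_in ?ell_norm0// => xp yp.
apply: (le_lt_trans (ell_normD _ _)); rewrite lte_add_pinfty//.
by rewrite ell_normZ lte_mul_pinfty// ?lee_fin ?rnorm_ge0.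
Qed.

HB.instance Definition _ :=
  GRing.isSubmodClosed.Build K (nat -> K^o) (in_ell p) ell_submod_closed.

(* The proof [q1] is a parameter so that the normed module structure is found
   by inference, as in [LfunType]. *)
Record ell (q1 : (1 <= p)%E) :=
  Ell { ell_seq :> nat -> K^o; _ : ell_seq \in in_ell p }.

HB.instance Definition _ := [isSub for @ell_seq p1].
HB.instance Definition _ := [Choice of ell p1 by <:].
HB.instance Definition _ := [SubChoice_isSubLmodule of ell p1 by <:].

Let nm (x : ell p1) : K := of_real (fine (ell_norm p x)).

Let ell_norm_fin (x : ell p1) : ell_norm p x \is a fin_num.
Proof. by rewrite ge0_fin_numE ?ell_norm_ge0//; exact: valP x. Qed.

Let nmD (x y : ell p1) : nm (x + y) <= nm x + nm y.
Proof.
rewrite /nm -of_realD le_of_real -lee_fin EFinD !fineK ?ell_norm_fin//.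
exact: ell_normD.
Qed.

Let nmZ (a : K) (x : ell p1) : nm (a *: x) = `|a| * nm x.
Proof.
rewrite -(rnormK (a : K^o)) /nm -of_realM; congr of_real.
by rewrite ell_normZ fineM ?ell_norm_fin.
Qed.

Let nm_eq0 (x : ell p1) : nm x = 0 -> x = 0.
Proof.
move=> x0; apply/val_inj/ell_norm_eq0.
have x00 : fine (ell_norm p x) = 0.
  by apply: (can_inj (@of_realK R s)); rewrite of_real0.
by rewrite -(fineK (ell_norm_fin x)) x00.
Qed.

HB.instance Definition _ :=
  Lmodule_isNormed.Build K (ell p1) nmD nmZ nm_eq0.

Lemma ell_rnormE (x : ell p1) : (rnorm x)%:E = ell_norm p x.
Proof. by rewrite /rnorm /Num.norm/= of_realK fineK ?ell_norm_fin. Qed.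

End Closure.
End EllSpace.

Section Operators.
Context {R : realType} {s : scalar_kind}.
Local Notation K := (scalars R s).

(* The closed unit ball of the dual: a bounded functional [phi] has operator
   norm [sup_(|x| <= 1) |phi x|]. *)
Definition dual_unit_ball (E : normedModType K) : set {linear E -> K^o} :=
  [set phi | forall x : E, rnorm x <= 1 -> rnorm (phi x) <= 1].

Definition weakly_summable (E : normedModType K) : set (nat -> E) :=
  [set x | (ereal_sup [set (\sum_(0 <= j <oo) (rnorm (phi (x j)))%:E)%E
              | phi in @dual_unit_ball E] < +oo)%E].

Definition multilinear m (E F : normedModType K) (T : ('I_m -> E) -> F) :=
  forall (x : 'I_m -> E) (i : 'I_m) (a : K) (u v : E),
    T (dfwith x i (a *: u + v)) = a *: T (dfwith x i u) + T (dfwith x i v).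

Definition bounded_multilinear m (E F : normedModType K) :
    set (('I_m -> E) -> F) :=
  [set T | multilinear T /\
    exists C : R, forall x, rnorm (T x) <= C * \prod_(i < m) rnorm (x i)].

Definition diagonal_indices m (I : {set {set 'I_m}}) :
    set {ffun 'I_m -> nat} :=
  [set j | forall B, B \in I -> {in B &, forall a b, j a = j b}].

Definition partially_summing m (I : {set {set 'I_m}}) (r : R)
    (E F : normedModType K) : set (('I_m -> E) -> F) :=
  [set T | bounded_multilinear T /\
    forall x : 'I_m -> nat -> E, (forall i, weakly_summable (x i)) ->
      (\esum_(j in diagonal_indices I)
         (rnorm (T (fun i => x i (j i))) `^ r)%:E < +oo)%E].

End Operators.

Arguments bounded_multilinear {R s} m E F.
Arguments partially_summing {R s m} I r E F.

(* The neutral value [m] does not matter for a nonempty family of blocks, whose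
   cardinals are at most [m]. *)
Definition min_block_card m (I : {set {set 'I_m}}) : nat :=
  \big[minn/m]_(B in I) #|B|.

Definition summing_exponent {R : realType} (n : nat) (p : \bar R) : R :=
  match p with
  | q%:E => if q <= 2 then 2 * q / (n%:R * q + 2 * q - 2)
            else 2 * q / (n%:R * q + 2)
  | _ => 2 / n%:R
  end.

(* Main.v *)
From HB Require Import structures.
Require Import Defs.
From mathcomp Require Import all_boot all_order all_algebra.
From mathcomp Require Import complex finmap.
From mathcomp Require Import all_classical all_reals all_analysis.
From mathcomp Require Import ring lra zify.
Set Implicit Arguments.
Unset Strict Implicit.
Unset Printing Implicit Defensive.
Import Order.TTheory GRing.Theory Num.Theory.
Import numFieldNormedType.Exports.
Local Open Scope classical_set_scope.
Local Open Scope ring_scope.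

(** Fix weakly summable sequences x^1, ..., x^m in l_1. Truncated to finitely
    many coordinates, each is a finite real matrix X^i (a complex coordinate
    counts as two real ones), and weak summability bounds the bilinear form of
    X^i on the unit balls for the sup norm, uniformly in the truncation.
    Grothendieck's inequality, in its factorization form [common_weights],
    gives X^i_(b,u) = sqrt(D_b) A^i_(b,u) sqrt(E_u) with weights D and E of
    bounded mass and contractions A^i of l_2. Tensor products of contractions
    are contractions ([tensor_contraction]); hence, for T bounded and
    multilinear with values in l_p,
      T(x^1_(b_1), ..., x^m_(b_m)) = h_b sqrt(D_(b_1) ... D_(b_m)),
    where h is the image of the bounded l_p-valued function
    a |-> T(e_(a_1), ..., e_(a_m)) under a contraction from L_2 of a finite
    measure to l_2.

    The norms of h are q-th power summable with q = max(p, p'):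
    - for 2 <= p < oo one works coordinate by coordinate, L_p being contained in
      L_2 and l_2 in l_p ([contraction_powR]);
    - for 1 < p < 2 one argues by duality; the interpolation between p = 1 and
      p = 2 is done by hand, splitting the kernel x^(1/p) y^(1/p') into a part
      of Hilbert space type and a remainder at most x
      ([power_split], [min_multiplier], [contraction_dual_exponent]);
    - for p = 1 and p = oo, h is merely bounded ([weights_row_bound]).
    On the other hand, on the index set of the theorem the product of the
    D_(b_i) is a product over the blocks B of powers D^|B|, with |B| >= n, so
    its power 1/n has a bounded sum ([diagonal_weight_sum]). Since
    1/t = n/2 + 1/q, the two facts together give summability of the t-th powers
    ([diagonal_power_sum]).

    For the optimality, let B be a block with n elements and, for c in the
    dyadic interval [2^k, 2^(k+1)), let w_c be the row number c of the Walsh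
    matrix of order 2^k, supported in that interval. The operator
      T(x)_c = 2^(-k/p) prod_(i in B) <w_c, x_i> prod_(i not in B) x_i(0)
    is bounded into l_p. The vectors rho^k 2^(-3k/2) w_c form a weakly summable
    sequence for every rho < 1 and, by orthogonality of the rows, T takes on
    them values of norm at least (2^(-1/p) (rho / sqrt 2)^n)^k. The interval has
    2^k elements, so for r < t and rho close enough to 1 the r-th powers are not
    summable ([walsh_operator_not_summing]). *)

(** * Grothendieck's inequality *)

Section Grothendieck.
Context {R : realType}.

(** Independent signs, added one at a time: each new sign doubles the finite
    probability space, and the odd powers of the new term cancel in the average. *)
Lemma rademacher_moments_nat (n : nat) :
  exists (T : finType) (r : nat -> T -> R), (0 < #|T|)%N /\
  forall u : nat -> R,
    \sum_t (\sum_(i < n) u i * r i t) ^+ 2 = #|T|%:R * \sum_(i < n) u i ^+ 2 /\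
    \sum_t (\sum_(i < n) u i * r i t) ^+ 4 <=
      3 * #|T|%:R * (\sum_(i < n) u i ^+ 2) ^+ 2.
Proof.
elim: n => [|n [T [r [T0 IH]]]].
  exists unit, (fun _ _ => 0); rewrite card_unit; split=> // u.
  by split; rewrite !big_ord0 big1 ?expr0n/= ?mulr0// => t _; rewrite big_ord0 expr0n.
exists (T * bool)%type,
  (fun i (tb : T * bool) => if i == n then (-1) ^+ tb.2 else r i tb.1).
rewrite card_prod card_bool; split; first by rewrite muln_gt0 T0.
move=> u; have [f2 f4] := IH u.
pose f t := \sum_(i < n) u i * r i t.
have E (t : T * bool) : \sum_(i < n.+1)
    u i * (if i == n :> nat then (-1) ^+ t.2 else r i t.1) =
    f t.1 + (-1) ^+ t.2 * u n.
  rewrite big_ord_recr/= eqxx mulrC [X in _ + X]mulrC; congr (_ + _); last first.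
    by rewrite mulrC.
  by apply: eq_bigr => i _; rewrite ltn_eqF.
have S (k : nat) : \sum_(t : T * bool) (\sum_(i < n.+1)
    u i * (if i == n :> nat then (-1) ^+ t.2 else r i t.1)) ^+ k =
    \sum_t ((f t + u n) ^+ k + (f t - u n) ^+ k).
  under eq_bigr do rewrite E.
  rewrite -(pair_bigA _ (fun x y => (f x + (-1) ^+ (y : bool) * u n) ^+ k))/=.
  apply: eq_bigr => t _.
  by rewrite big_bool/= expr0 expr1 mulN1r mul1r addrC.
split.
- rewrite S.
  transitivity (\sum_t (2 * f t ^+ 2 + 2 * u n ^+ 2)).
    by apply: eq_bigr => t _; ring.
  rewrite big_split/= -mulr_sumr f2 sumr_const big_ord_recr/= natrM.
  rewrite -[_ *+ #|_|]mulr_natl; ring.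
- rewrite S.
  have -> : \sum_t ((f t + u n) ^+ 4 + (f t - u n) ^+ 4) =
      \sum_t (2 * f t ^+ 4 + (12 * u n ^+ 2 * f t ^+ 2 + 2 * u n ^+ 4)).
    by apply: eq_bigr => t _; ring.
  rewrite big_split/= big_split/= -!mulr_sumr f2 sumr_const big_ord_recr/= natrM.
  rewrite -[_ *+ #|_|]mulr_natl.
  set s := \sum_(i < n) _ in f4 *.
  set N := #|T|%:R in f4 *.
  have N0 : 0 <= N by rewrite ler0n.
  have := mulr_ge0 N0 (exprn_even_ge0 (n:=4) (u n) isT).
  by move: f4; rewrite -/(f _); under [X in X <= _]eq_bigr do rewrite -/(f _);
     nra.
Qed.

Lemma rademacher_moments (I : finType) :
  exists (T : finType) (r : I -> T -> R), (0 < #|T|)%N /\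
  (forall u v : I -> R,
    \sum_t (\sum_i u i * r i t) * (\sum_i v i * r i t) =
      #|T|%:R * \sum_i u i * v i) /\
  (forall u : I -> R,
    \sum_t (\sum_i u i * r i t) ^+ 4 <= 3 * #|T|%:R * (\sum_i u i ^+ 2) ^+ 2).
Proof.
have [T [r [T0 rad]]] := rademacher_moments_nat #|I|.
exists T, (fun i => r (enum_rank i)).
pose ext (u : I -> R) (k : nat) : R :=
  if insub k is Some o then u (@enum_val I I o) else 0.
have extE (u : I -> R) (G : R -> (T -> R) -> R) :
    \sum_i G (u i) (r (enum_rank i)) = \sum_(k < #|I|) G (ext u k) (r k).
  rewrite (reindex (@enum_val I I)) /=; last exact/onW_bij/enum_val_bij.
  by apply: eq_bigr => k _; rewrite /ext valK enum_valK.
have sq (u : I -> R) : \sum_t (\sum_i u i * r (enum_rank i) t) ^+ 2 =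
    #|T|%:R * \sum_i u i ^+ 2.
  have [+ _] := rad (ext u); rewrite -(extE u (fun x _ => x ^+ 2)) => <-.
  by apply: eq_bigr => t _; rewrite -(extE u (fun x r => x * r t)).
split=> //; split=> [u v|u]; last first.
  have [_] := rad (ext u); rewrite -(extE u (fun x _ => x ^+ 2)).
  by under eq_bigr do rewrite -(extE u (fun x r => x * r _)).
have := sq (fun i => u i + v i).
have -> : \sum_i (u i + v i) ^+ 2 =
    \sum_i u i ^+ 2 + (\sum_i v i ^+ 2 + 2 * \sum_i u i * v i).
  by rewrite mulr_sumr -!big_split; apply: eq_bigr => i _ /=; ring.
have -> : \sum_t (\sum_i (u i + v i) * r (enum_rank i) t) ^+ 2 =
    \sum_t (\sum_i u i * r (enum_rank i) t) ^+ 2 +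
    (\sum_t (\sum_i v i * r (enum_rank i) t) ^+ 2 +
    2 * \sum_t (\sum_i u i * r (enum_rank i) t) * (\sum_i v i * r (enum_rank i) t)).
  rewrite mulr_sumr -!big_split; apply: eq_bigr => t _ /=.
  by under eq_bigr do rewrite mulrDl; rewrite big_split/=; ring.
rewrite !sq; lra.
Qed.

(** [W] bounds the norm of [X] as an operator from l_oo to l_1. *)
Definition bilinear_bound (A J : finType) (X : A -> J -> R) (W : R) :=
  forall (x : A -> R) (y : J -> R),
    (forall a, `|x a| <= 1) -> (forall j, `|y j| <= 1) ->
    \sum_a \sum_j X a j * (x a * y j) <= W.

(** The same form evaluated on unit vectors of Euclidean spaces of arbitrary
    dimension, presented in coordinates indexed by [T]. *)
Definition vector_bound (A J : finType) (X : A -> J -> R) (S : R) :=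
  forall (T : finType) (u : A -> T -> R) (v : J -> T -> R),
    (forall a, \sum_t u a t ^+ 2 <= 1) -> (forall j, \sum_t v j t ^+ 2 <= 1) ->
    \sum_a \sum_j X a j * (\sum_t u a t * v j t) <= S.

Lemma vector_bound_scale (A J : finType) (X : A -> J -> R) (S al be : R)
    (T : finType) (u : A -> T -> R) (v : J -> T -> R) :
  vector_bound X S -> 0 < al -> 0 < be ->
  (forall a, \sum_t u a t ^+ 2 <= al ^+ 2) ->
  (forall j, \sum_t v j t ^+ 2 <= be ^+ 2) ->
  \sum_a \sum_j X a j * (\sum_t u a t * v j t) <= S * (al * be).
Proof.
move=> SX al0 be0 u1 v1; rewrite -ler_pdivrMr ?mulr_gt0//.
have E : (\sum_a \sum_j X a j * (\sum_t u a t * v j t)) / (al * be) =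
    \sum_a \sum_j X a j * (\sum_t u a t / al * (v j t / be)).
  rewrite mulr_suml; apply: eq_bigr => a _.
  rewrite mulr_suml; apply: eq_bigr => j _.
  rewrite -mulrA mulr_suml; congr (_ * _); apply: eq_bigr => t _.
  by rewrite invfM mulrACA.
rewrite E; apply: SX => [a|j].
  under eq_bigr do rewrite expr_div_n; rewrite -mulr_suml.
  by rewrite ler_pdivrMr ?exprn_gt0// mul1r.
under eq_bigr do rewrite expr_div_n; rewrite -mulr_suml.
by rewrite ler_pdivrMr ?exprn_gt0// mul1r.
Qed.

Lemma inner_le1 (T : finType) (u v : T -> R) :
  \sum_t u t ^+ 2 <= 1 -> \sum_t v t ^+ 2 <= 1 -> `|\sum_t u t * v t| <= 1.
Proof.
move=> u1 v1; apply: (le_trans (ler_norm_sum _ _ _)).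
apply: (@le_trans _ _ (\sum_t (u t ^+ 2 + v t ^+ 2) / 2)).
  apply: ler_sum => t _; rewrite normrM -(real_normK (num_real (u t))).
  rewrite -(real_normK (num_real (v t))).
  by have := sqr_ge0 (`|u t| - `|v t|); nra.
by rewrite -mulr_suml big_split/=; lra.
Qed.

Definition clip2 (x : R) : R := Num.max (-2) (Num.min 2 x).

(** The tail estimate is [|x| - 2 <= x^2 / 8], that is [0 <= (|x| - 4)^2]. With
    a fourth moment at most 3, it leaves a tail of L_2 norm below 1/4. *)
Lemma clip2P x : [/\ `|clip2 x| <= 2, clip2 x ^+ 2 <= x ^+ 2 &
  (x - clip2 x) ^+ 2 <= x ^+ 4 / 64].
Proof.
rewrite /clip2 /Num.max /Num.min; case: ifP => [|/negbT]; case: ifP => [|/negbT];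
  rewrite -?leNgt => h1 h2; rewrite ?ler_norml.
- split; try nra.
  rewrite (_ : x ^+ 4 / 64 = (x ^+ 2 / 8) ^+ 2); last by field.
  have := sqr_ge0 (x - 4); nra.
- by split; rewrite ?subrr ?expr0n/= ?divr_ge0 ?exprn_even_ge0//; lra.
- by split; lra.
- split; try nra.
  rewrite (_ : x ^+ 4 / 64 = (x ^+ 2 / 8) ^+ 2); last by field.
  have := sqr_ge0 (x + 4); nra.
Qed.

(** Near-maximizers take the place of a compactness argument. *)
Lemma sup_vector_bound (A J : finType) (X : A -> J -> R) :
  exists S : R, vector_bound X S /\ forall s, s < S ->
    exists (T : finType) (u : A -> T -> R) (v : J -> T -> R),
    [/\ (forall a, \sum_t u a t ^+ 2 <= 1), (forall j, \sum_t v j t ^+ 2 <= 1) &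
     s < \sum_a \sum_j X a j * (\sum_t u a t * v j t)].
Proof.
pose E : set R := [set s | exists (T : finType) (u : A -> T -> R) (v : J -> T -> R),
    [/\ (forall a, \sum_t u a t ^+ 2 <= 1), (forall j, \sum_t v j t ^+ 2 <= 1) &
     s = \sum_a \sum_j X a j * (\sum_t u a t * v j t)]].
have supE : has_sup E.
  split.
    exists (\sum_a \sum_j X a j * (\sum_(t : unit) 0 * 0)), unit,
      (fun _ _ => 0), (fun _ _ => 0).
    by split=> // ?; rewrite big1// => t _; rewrite expr0n.
  exists (\sum_a \sum_j `|X a j|) => _ [T [u [v [u1 v1 ->]]]].
  apply: ler_sum => a _; apply: ler_sum => j _.
  rewrite (le_trans (ler_norm _))// normrM -[leRHS]mulr1 ler_wpM2l//.
  exact: inner_le1.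
exists (sup E); split=> [T u v u1 v1|s sS].
  by apply: sup_upper_bound => //; exists T, u, v.
have e0 : 0 < sup E - s by rewrite subr_gt0.
have [_ [T [u [v [u1 v1 ->]]]] +] := sup_adherent e0 supE.
by rewrite subKr => lt; exists T, u, v.
Qed.

(** Unit vectors become Rademacher sums. Clipping these at level 2 leaves bounded
    functions, controlled by [W], and tails of L_2 norm at most 1/4, controlled by
    the supremum [S] itself; hence [S <= 4 W + S / 4 + S / 4]. *)
Lemma grothendieck (A J : finType) (X : A -> J -> R) (W : R) :
  bilinear_bound X W -> vector_bound X (8 * W).
Proof.
move=> XW; have [S [SX nearS]] := sup_vector_bound X.
suff S8 : S <= 4 * W + S / 2.
  by move=> T u v u1 v1; apply: (le_trans (SX T u v u1 v1)); lra.
rewrite leNgt; apply/negP => /nearS[I [u [v [u1 v1]]]]; apply/negP; rewrite -leNgt.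
have [T [r [T0 [rad2 rad4]]]] := rademacher_moments I.
pose f a t := \sum_i u a i * r i t; pose g j t := \sum_i v j i * r i t.
set n : R := #|T|%:R in rad2 rad4; have n0 : 0 < n by rewrite ltr0n.
have mom (w : I -> R) : \sum_i w i ^+ 2 <= 1 ->
    \sum_t (\sum_i w i * r i t) ^+ 2 <= n /\
    \sum_t (\sum_i w i * r i t - clip2 (\sum_i w i * r i t)) ^+ 2 <= n / 16.
  move=> w1; split.
    under eq_bigr do rewrite expr2; rewrite rad2 -[leRHS]mulr1 ler_pM2l//.
  apply: (@le_trans _ _ (\sum_t (\sum_i w i * r i t) ^+ 4 / 64)).
    by apply: ler_sum => t _; have [] := clip2P (\sum_i w i * r i t).
  rewrite -mulr_suml.
  have w2 : (\sum_i w i ^+ 2) ^+ 2 <= 1.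
    by apply: exprn_ile1 => //; apply: sumr_ge0 => i _; exact: sqr_ge0.
  have := rad4 w; have := ler_wpM2l (ltW n0) w2; lra.
have clipmom (w : I -> R) : \sum_i w i ^+ 2 <= 1 ->
    \sum_t (clip2 (\sum_i w i * r i t)) ^+ 2 <= n.
  move=> w1; apply: le_trans (mom w w1).1; apply: ler_sum => t _.
  by have [] := clip2P (\sum_i w i * r i t).
have sqn : Num.sqrt n ^+ 2 = n by rewrite sqr_sqrtr// ltW.
have sn0 : 0 < Num.sqrt n by rewrite sqrtr_gt0.
have sqn4 : (Num.sqrt n / 4) ^+ 2 = n / 16 by rewrite expr_div_n sqn; lra.
have sn4 : 0 < Num.sqrt n / 4 by rewrite divr_gt0.
rewrite -(ler_pM2l n0).
have -> : n * (\sum_a \sum_j X a j * (\sum_t u a t * v j t)) =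
    \sum_a \sum_j X a j * (\sum_t clip2 (f a t) * clip2 (g j t)) +
    \sum_a \sum_j X a j * (\sum_t (f a t - clip2 (f a t)) * clip2 (g j t)) +
    \sum_a \sum_j X a j * (\sum_t f a t * (g j t - clip2 (g j t))).
  rewrite -!big_split mulr_sumr; apply: eq_bigr => a _ /=.
  rewrite -!big_split mulr_sumr; apply: eq_bigr => j _ /=.
  rewrite mulrCA -rad2 -!mulrDr; congr (_ * _).
  by rewrite -!big_split; apply: eq_bigr => t _ /=; rewrite -/(f a t) -/(g j t); ring.
have H1 : \sum_a \sum_j X a j * (\sum_t clip2 (f a t) * clip2 (g j t)) <=
    n * (4 * W).
  have -> : \sum_a \sum_j X a j * (\sum_t clip2 (f a t) * clip2 (g j t)) =
      \sum_t 4 * \sum_a \sum_j X a j * ((clip2 (f a t) / 2) * (clip2 (g j t) / 2)).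
    under eq_bigr do under eq_bigr do rewrite mulr_sumr.
    under eq_bigr do rewrite exchange_big/=.
    rewrite exchange_big/=; apply: eq_bigr => t _.
    rewrite mulr_sumr; apply: eq_bigr => a _.
    by rewrite mulr_sumr; apply: eq_bigr => j _; field.
  rewrite /n mulr_natl -sumr_const; apply: ler_sum => t _.
  rewrite ler_pM2l//; apply: XW => [a|j]; rewrite normrM [ `|2^-1| ]gtr0_norm ?invr_gt0//;
    rewrite ler_pdivrMr// mul1r.
    by have [] := clip2P (f a t).
  by have [] := clip2P (g j t).
have H2 : \sum_a \sum_j X a j *
    (\sum_t (f a t - clip2 (f a t)) * clip2 (g j t)) <= S * (Num.sqrt n / 4 * Num.sqrt n).
  apply: vector_bound_scale => // [a|j]; rewrite ?sqn4 ?sqn.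
    exact: (mom (u a) (u1 a)).2.
  exact: clipmom.
have H3 : \sum_a \sum_j X a j *
    (\sum_t f a t * (g j t - clip2 (g j t))) <= S * (Num.sqrt n * (Num.sqrt n / 4)).
  apply: vector_bound_scale => // [a|j]; rewrite ?sqn4 ?sqn.
    exact: (mom (u a) (u1 a)).1.
  exact: (mom (v j) (v1 j)).2.
have ss : Num.sqrt n * Num.sqrt n = n by rewrite -expr2.
nra.
Qed.

End Grothendieck.

(** * Factorization of bounded bilinear forms *)

Section Weights.
Context {R : realType}.

Lemma sum2D (A J : finType) (F G : A -> J -> R) :
  \sum_a \sum_j (F a j + G a j) =
  \sum_a \sum_j F a j + \sum_a \sum_j G a j.
Proof. by rewrite -big_split; apply: eq_bigr => a _; rewrite big_split. Qed.

Lemma sum2Z (A J : finType) (F : A -> J -> R) (c : R) :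
  \sum_a \sum_j (c * F a j) = c * \sum_a \sum_j F a j.
Proof. by rewrite mulr_sumr; apply: eq_bigr => a _; rewrite mulr_sumr. Qed.

Lemma norm_mul_le1 (a b : R) : `|a| <= 1 -> `|b| <= 1 -> `|a * b| <= 1.
Proof. by move=> a1 b1; rewrite normrM mulr_ile1. Qed.

Lemma norm_sqr_le1 (a : R) : `|a| <= 1 -> `|a ^+ 2| <= 1.
Proof. by move=> a1; rewrite normrX exprn_ile1. Qed.

(** The weights are Lagrange multipliers: turn every vector of a near-maximizer
    slightly towards one new direction, by an angle proportional to [x a] or
    [y j]. The second-order variation of the form cannot exceed the distance to
    the supremum, and this is the inequality; [dl] accounts for that distance
    and for the terms of higher order. *)
Lemma grothendieck_weights_small (A J : finType) (X : A -> J -> R) (W dl : R) :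
  bilinear_bound X W -> 0 < dl ->
  exists (l : A -> R) (mu : J -> R),
    [/\ \sum_a l a <= 8 * W, \sum_j mu j <= 8 * W &
     forall x y, (forall a, `|x a| <= 1) -> (forall j, `|y j| <= 1) ->
       2 * \sum_a \sum_j X a j * (x a * y j) <=
       \sum_a l a * x a ^+ 2 + \sum_j mu j * y j ^+ 2 + dl].
Proof.
move=> XW dl0; have [S [SX nearS]] := sup_vector_bound X.
pose B := \sum_a \sum_j `|X a j|.
have B0 : 0 <= B by apply: sumr_ge0 => a _; apply: sumr_ge0.
pose th := Num.min (1 / 2) (dl / (2 * (1 + 3 * B))).
have c0 : 0 < 2 * (1 + 3 * B) by lra.
have th0 : 0 < th by rewrite lt_min divr_gt0// divr_gt0.
have th1 : th <= 1 / 2 by rewrite ge_min lexx.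
have thd : th * (2 * (1 + 3 * B)) <= dl.
  by rewrite -ler_pdivlMr// ge_min lexx orbT.
have th2 : S - th ^+ 2 < S by rewrite ltrBlDr ltrDl exprn_gt0.
have [T [u [v [u1 v1 near]]]] := nearS _ th2.
pose g a j := \sum_t u a t * v j t.
have g1 a j : `|g a j| <= 1 by exact: inner_le1.
exists (fun a => \sum_j X a j * g a j), (fun j => \sum_a X a j * g a j); split.
- exact: (grothendieck XW u1 v1).
- by rewrite exchange_big; exact: (grothendieck XW u1 v1).
move=> x y x1 y1.
(* An exact rotation would have the factor [sqrt (1 - th x^2)] in place of
   [1 - k th x^2]; the excess of [k] over 1/2 keeps the vectors in the unit ball. *)
pose k := 1 / 2 + th.
pose al a := k * th * x a ^+ 2; pose be j := k * th * y j ^+ 2.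
pose u' a (t : option T) := if t is Some t then (1 - al a) * u a t else Num.sqrt th * x a.
pose v' j (t : option T) := if t is Some t then (1 - be j) * v j t else Num.sqrt th * y j.
have sqth : Num.sqrt th ^+ 2 = th by rewrite sqr_sqrtr// ltW.
have sumopt (F : option T -> R) : \sum_o F o = F None + \sum_t F (Some t).
  rewrite (bigD1 None)//=; congr (_ + _).
  rewrite (reindex_omap Some id)/=; last by case.
  by apply: eq_bigl => t; rewrite eqxx.
have unit (U : T -> R) (z : R) : \sum_t U t ^+ 2 <= 1 -> `|z| <= 1 ->
    (Num.sqrt th * z) ^+ 2 + \sum_t ((1 - k * th * z ^+ 2) * U t) ^+ 2 <= 1.
  move=> U1 z1; under eq_bigr do rewrite exprMn; rewrite -mulr_sumr exprMn sqth.
  have z2 : z ^+ 2 <= 1 by rewrite -(real_normK (num_real z)) exprn_ile1.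
  have z20 := sqr_ge0 z.
  apply: (@le_trans _ _ (th * z ^+ 2 + (1 - k * th * z ^+ 2) ^+ 2)).
    by rewrite lerD2l -[leRHS]mulr1 ler_wpM2l// sqr_ge0.
  have kk : k ^+ 2 <= 1 by rewrite /k exprn_ile1//; lra.
  have : th ^+ 2 * z ^+ 2 * (k ^+ 2 * z ^+ 2) <= th ^+ 2 * z ^+ 2 * 1.
    apply: ler_wpM2l; first by rewrite mulr_ge0// sqr_ge0.
    by apply: mulr_ile1 => //; exact: sqr_ge0.
  rewrite /k; have := mulr_ge0 (sqr_ge0 th) z20; nra.
have := SX _ u' v'.
have -> : \sum_a \sum_j X a j * (\sum_o u' a o * v' j o) =
    \sum_a \sum_j (X a j * g a j + (th * (X a j * (x a * y j)) +
      (- (k * th) * (X a j * g a j * x a ^+ 2) +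
      (- (k * th) * (X a j * g a j * y j ^+ 2) + X a j * (al a * be j * g a j))))).
  apply: eq_bigr => a _; apply: eq_bigr => j _.
  rewrite sumopt /=.
  under eq_bigr do rewrite mulrACA; rewrite -mulr_sumr -/(g a j).
  rewrite mulrACA -[_ * Num.sqrt th]expr2 sqth /al /be; ring.
rewrite 4!sum2D !sum2Z.
set s := \sum_a \sum_j X a j * (\sum_t u a t * v j t) in near.
rewrite -/s.
have -> : \sum_a \sum_j X a j * g a j * x a ^+ 2 =
    \sum_a (\sum_j X a j * g a j) * x a ^+ 2.
  by apply: eq_bigr => a _; rewrite mulr_suml.
have -> : \sum_a \sum_j X a j * g a j * y j ^+ 2 =
    \sum_j (\sum_a X a j * g a j) * y j ^+ 2.
  by rewrite exchange_big; apply: eq_bigr => j _; rewrite mulr_suml.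
set P1 := \sum_a _ * _; set P2 := \sum_j _ * _; set Q := \sum_a \sum_j _.
set Err := \sum_a \sum_j _.
move=> /(_ _ _) H.
have {}H : s + (th * Q + (- (k * th) * P1 + (- (k * th) * P2 + Err))) <= S.
  by apply: H => [a|j]; rewrite sumopt /=; exact: unit.
have P1B : P1 <= B.
  apply: ler_sum => a _; rewrite mulr_suml; apply: ler_sum => j _.
  rewrite (le_trans (ler_norm _))// -mulrA normrM -[leRHS]mulr1 ler_wpM2l//.
  by apply: norm_mul_le1 => //; exact: norm_sqr_le1.
have P2B : P2 <= B.
  rewrite /B exchange_big; apply: ler_sum => j _; rewrite mulr_suml; apply: ler_sum => a _.
  rewrite (le_trans (ler_norm _))// -mulrA normrM -[leRHS]mulr1 ler_wpM2l//.
  by apply: norm_mul_le1 => //; exact: norm_sqr_le1.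
have k1 : k <= 1 by rewrite /k; lra.
have k0 : 0 <= k by rewrite /k; lra.
have ErrB : - (th ^+ 2 * B) <= Err.
  rewrite -lerN2 opprK -sumrN mulr_sumr; apply: ler_sum => a _.
  rewrite -sumrN mulr_sumr; apply: ler_sum => j _.
  rewrite (le_trans (ler_norm _))// normrN normrM mulrC ler_wpM2r//.
  rewrite /al /be (_ : _ * g a j = th ^+ 2 * (k ^+ 2 * (x a ^+ 2 * (y j ^+ 2 * g a j)))); last by ring.
  rewrite normrM ger0_norm ?sqr_ge0// -[leRHS]mulr1 ler_wpM2l ?sqr_ge0//.
  apply: norm_mul_le1; first by apply: norm_sqr_le1; rewrite ger0_norm.
  apply: norm_mul_le1; first exact: norm_sqr_le1.
  by apply: norm_mul_le1 => //; exact: norm_sqr_le1.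
rewrite -/P1.
have thP : th * (P1 + P2) <= th * (2 * B) by apply: ler_wpM2l; [exact: ltW|lra].
rewrite -(ler_pM2l th0).
have := ler_wpM2l (ltW th0) thd.
have := ler_wpM2l (ltW th0) thP.
move: H; rewrite /k; nra.
Qed.

(** On the Euclidean unit sphere all coordinates are at most 1 and [dl] equals
    [dl] times the squared norm, so the slack of [grothendieck_weights_small] is
    absorbed into the weights. Nonnegativity of the weights is the inequality at
    the basis vectors. *)
Lemma grothendieck_weights (A J : finType) (X : A -> J -> R) (W : R) :
  bilinear_bound X W ->
  exists (E : A -> R) (D : J -> R),
    [/\ forall a, 0 <= E a, forall j, 0 <= D j, \sum_a E a <= 8 * W + 1,
     \sum_j D j <= 8 * W + 1 &
     forall x y, 2 * \sum_a \sum_j X a j * (x a * y j) <=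
       \sum_a E a * x a ^+ 2 + \sum_j D j * y j ^+ 2].
Proof.
move=> XW; pose N : R := (#|A| + #|J|).+1%:R.
have N0 : 0 < N by rewrite ltr0n.
have dl0 : 0 < N^-1 by rewrite invr_gt0.
have [l [mu [l1 mu1 small]]] := grothendieck_weights_small XW dl0.
exists (fun a => l a + N^-1), (fun j => mu j + N^-1).
have main x y : 2 * \sum_a \sum_j X a j * (x a * y j) <=
       \sum_a (l a + N^-1) * x a ^+ 2 + \sum_j (mu j + N^-1) * y j ^+ 2.
  pose n2 := \sum_a x a ^+ 2 + \sum_j y j ^+ 2.
  have sx0 : 0 <= \sum_a x a ^+ 2 by apply: sumr_ge0 => a _; exact: sqr_ge0.
  have sy0 : 0 <= \sum_j y j ^+ 2 by apply: sumr_ge0 => a _; exact: sqr_ge0.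
  have xn a : x a ^+ 2 <= n2.
    apply: (@le_trans _ _ (\sum_a x a ^+ 2)); last by rewrite /n2 lerDl.
    by rewrite (bigD1 a)//= lerDl sumr_ge0// => i _; exact: sqr_ge0.
  have yn j : y j ^+ 2 <= n2.
    apply: (@le_trans _ _ (\sum_j y j ^+ 2)); last by rewrite /n2 lerDr.
    by rewrite (bigD1 j)//= lerDl sumr_ge0// => i _; exact: sqr_ge0.
  have [n20|n20] := eqVneq n2 0.
    have x0 a : x a = 0.
      by apply/eqP; rewrite -sqrf_eq0 eq_le sqr_ge0 andbT -n20.
    have y0 j : y j = 0.
      by apply/eqP; rewrite -sqrf_eq0 eq_le sqr_ge0 andbT -n20.
    have -> : \sum_a \sum_j X a j * (x a * y j) = 0.
      by rewrite big1// => a _; rewrite big1// => j _; rewrite x0 mul0r mulr0.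
    have -> : \sum_a (l a + N^-1) * x a ^+ 2 = 0.
      by rewrite big1// => a _; rewrite x0 expr0n mulr0.
    have -> : \sum_j (mu j + N^-1) * y j ^+ 2 = 0.
      by rewrite big1// => j _; rewrite y0 expr0n mulr0.
    by rewrite addr0 mulr0.
  have n2p : 0 < n2 by rewrite lt_def n20 addr_ge0.
  pose M := Num.sqrt n2.
  have M0 : 0 < M by rewrite sqrtr_gt0.
  have MM : M ^+ 2 = n2 by rewrite sqr_sqrtr// ltW.
  have le1 z : z ^+ 2 <= n2 -> `|z / M| <= 1.
    move=> zn; rewrite normrM normfV (gtr0_norm M0) ler_pdivrMr// mul1r.
    by rewrite -(ler_pXn2r (_ : 0 < 2)%N) ?nnegrE ?(ltW M0)// real_normK ?num_real// MM.
  have := small (fun a => x a / M) (fun j => y j / M) _ _.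
  move=> /(_ (fun a => le1 _ (xn a)) (fun j => le1 _ (yn j))).
  have e1 : \sum_a \sum_j X a j * (x a / M * (y j / M)) =
      n2^-1 * \sum_a \sum_j X a j * (x a * y j).
    rewrite -sum2Z; apply: eq_bigr => a _; apply: eq_bigr => j _.
    by rewrite -MM; field; rewrite gt_eqF.
  have e2 (I : finType) (c z : I -> R) :
      \sum_i c i * (z i / M) ^+ 2 = n2^-1 * \sum_i c i * z i ^+ 2.
    by rewrite mulr_sumr; apply: eq_bigr => i _; rewrite expr_div_n MM; ring.
  rewrite e1 !e2 mulrCA -mulrDr -(ler_pM2l n2p) [leRHS]mulrDr !mulVKf ?gt_eqF//.
  move=> H; under [X in _ <= X + _]eq_bigr do rewrite mulrDl.
  under [X in _ <= _ + X]eq_bigr do rewrite mulrDl.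
  rewrite !big_split/= -!mulr_sumr; move: H; rewrite /n2 [_ * N^-1]mulrDl ![_ * N^-1]mulrC => H.
  by rewrite addrACA.
have sumE (I : finType) (i0 : I) (c : I -> R) : \sum_i c i * (i == i0)%:R ^+ 2 = c i0.
  rewrite (bigD1 i0)//= eqxx expr1n mulr1 big1 ?addr0// => i /negbTE ->.
  by rewrite expr0n mulr0.
have sum0 (I : finType) (c : I -> R) : \sum_i c i * 0 ^+ 2 = 0.
  by rewrite big1// => i _; rewrite expr0n mulr0.
split=> //.
- move=> a; have := main (fun a' => (a' == a)%:R) (fun=> 0); rewrite sumE sum0 addr0.
  by rewrite big1 ?mulr0// => i _; rewrite big1// => j _; rewrite !mulr0.
- move=> j; have := main (fun=> 0) (fun j' => (j' == j)%:R); rewrite sumE sum0 add0r.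
  by rewrite big1 ?mulr0// => i _; rewrite big1// => k _; rewrite mul0r mulr0.
- rewrite big_split/= lerD// sumr_const -[_ *+ _]mulr_natr mulrC ler_pdivrMr// mul1r.
  by rewrite ler_nat ltnW// ltnS leq_addr.
- rewrite big_split/= lerD// sumr_const -[_ *+ _]mulr_natr mulrC ler_pdivrMr// mul1r.
  by rewrite ler_nat ltnW// ltnS leq_addl.
Qed.

End Weights.

(** * Tensor products of weighted contractions *)

Section Tensor.
Context {R : realType}.

(** Weights may be enlarged, so those of the several forms can be added; scaling
    [x] against [y] then brings the mass of [D] below 1. The last inequality is
    the bilinear one at the point [(X g) b / D b]. *)
Lemma common_weights (m : nat) (U : finType) (X : 'I_m -> U -> U -> R) (W : R) :
  0 <= W -> (forall i, bilinear_bound (X i) W) ->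
  exists D E : U -> R,
    [/\ forall u, 0 < D u, \sum_u D u <= 1, forall u, 0 <= E u,
     \sum_u E u <= (m%:R * (8 * W + 1) + 1) ^+ 2 &
     forall i g, \sum_b (D b)^-1 * (\sum_u X i b u * g u) ^+ 2 <=
       \sum_u E u * g u ^+ 2].
Proof.
move=> W0 XW.
have [DE wDE] := choice (fun i =>
  let: ex_intro E (ex_intro D H) := grothendieck_weights (XW i) in
  ex_intro (fun DE : (U -> R) * (U -> R) => [/\ forall a, 0 <= DE.1 a, forall j, 0 <= DE.2 j,
    \sum_a DE.1 a <= 8 * W + 1, \sum_j DE.2 j <= 8 * W + 1 &
     forall x y, 2 * \sum_a \sum_j X i a j * (x a * y j) <=
       \sum_a DE.1 a * x a ^+ 2 + \sum_j DE.2 j * y j ^+ 2]) (E, D) H).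
set th := m%:R * (8 * W + 1) + 1.
have thm : 0 <= m%:R * (8 * W + 1) by rewrite mulr_ge0//; lra.
have th0 : 0 < th by rewrite /th; lra.
pose N : R := #|U|.+1%:R.
have N0 : 0 < N by rewrite ltr0n.
(* The summand [N^-1] makes the weights positive. *)
pose D0 u := \sum_i (DE i).1 u + N^-1; pose E0 u := \sum_i (DE i).2 u.
have D00 u : 0 < D0 u.
  rewrite /D0 -[ltLHS]addr0 ler_ltD ?invr_gt0// sumr_ge0// => i _.
  by have [] := wDE i.
have E00 u : 0 <= E0 u by apply: sumr_ge0 => i _; have [] := wDE i.
have sumM (F : 'I_m -> U -> R) : (forall i, \sum_u F i u <= 8 * W + 1) ->
    \sum_u \sum_i F i u <= m%:R * (8 * W + 1).
  move=> FW; rewrite exchange_big/=.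
  apply: (@le_trans _ _ (\sum_(i < m) (8 * W + 1))); first exact: ler_sum.
  by rewrite sumr_const card_ord -[leLHS]mulr_natl.
exists (fun u => D0 u / th), (fun u => th * E0 u); split.
- by move=> u; rewrite divr_gt0.
- rewrite -mulr_suml ler_pdivrMr// mul1r big_split/= lerD//.
    by apply: sumM => i; have [] := wDE i.
  rewrite sumr_const -[_ *+ _]mulr_natr mulrC ler_pdivrMr// mul1r.
  by rewrite ler_nat leqnSn.
- by move=> u; rewrite mulr_ge0// ltW.
- rewrite -mulr_sumr expr2 ler_pM2l// (@le_trans _ _ (m%:R * (8 * W + 1)))//; last by rewrite /th; lra.
  by apply: sumM => i; have [] := wDE i.
move=> i g; pose h b := \sum_u X i b u * g u.
have [D1 D2 _ _ main] := wDE i.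
rewrite [leLHS](eq_bigr (fun b => th * (h b ^+ 2 / D0 b))); last first.
  by move=> b _; rewrite invf_div -/(h b); ring.
rewrite [leRHS](eq_bigr (fun u => th * (E0 u * g u ^+ 2))); last first.
  by move=> b _; rewrite mulrA.
rewrite -!mulr_sumr ler_pM2l//.
have := main (fun b => h b / D0 b) g.
have -> : \sum_b \sum_u X i b u * (h b / D0 b * g u) = \sum_b h b ^+ 2 / D0 b.
  apply: eq_bigr => b _.
  under eq_bigr do rewrite mulrCA; rewrite -mulr_sumr -/(h b); ring.
move=> H.
have H1 : \sum_b (DE i).1 b * (h b / D0 b) ^+ 2 <= \sum_b h b ^+ 2 / D0 b.
  apply: ler_sum => b _.
  rewrite (_ : h b ^+ 2 / D0 b = D0 b * (h b / D0 b) ^+ 2); last first.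
    by field; rewrite gt_eqF.
  rewrite ler_wpM2r ?sqr_ge0// /D0 (bigD1 i)//=.
  rewrite -addrA lerDl addr_ge0 ?invr_ge0 ?(ltW N0)// sumr_ge0// => k _.
  by have [] := wDE k.
have H2 : \sum_u (DE i).2 u * g u ^+ 2 <= \sum_u E0 u * g u ^+ 2.
  apply: ler_sum => b _; rewrite ler_wpM2r ?sqr_ge0// /E0 (bigD1 i)//= lerDl.
  by rewrite sumr_ge0// => k _; have [] := wDE k.
move: H H1 H2; lra.
Qed.

Definition upd (m : nat) (U : Type) (b : {ffun 'I_m -> U}) (l : 'I_m) (u : U) :
  {ffun 'I_m -> U} := [ffun i => if i == l then u else b i].

Lemma upd_same m U (b : {ffun 'I_m -> U}) l u : upd b l u l = u.
Proof. by rewrite ffunE eqxx. Qed.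

Lemma upd_other m U (b : {ffun 'I_m -> U}) l u i : i != l -> upd b l u i = b i.
Proof. by rewrite ffunE => /negbTE ->. Qed.

Lemma upd_upd m U (b : {ffun 'I_m -> U}) l u v : upd (upd b l u) l v = upd b l v.
Proof. by apply/ffunP => i; rewrite !ffunE; case: eqP. Qed.

Lemma upd_id m U (b : {ffun 'I_m -> U}) l : upd b l (b l) = b.
Proof. by apply/ffunP => i; rewrite !ffunE; case: eqP => // ->. Qed.

(** Exchanging the new coordinate with the erased one is an involution of the
    pairs ([b], [u]). *)
Lemma line_sum m (U : finType) (l : 'I_m) (phi : {ffun 'I_m -> U} -> R) :
  #|U|%:R * \sum_b phi b = \sum_b \sum_u phi (upd b l u).
Proof.
rewrite (pair_bigA _ (fun b u => phi (upd b l u)))/=.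
pose s (p : {ffun 'I_m -> U} * U) := (upd p.1 l p.2, p.1 l).
have sK : involutive s.
  by move=> [b u]; rewrite /s/= upd_upd upd_id upd_same.
rewrite (reindex_inj (inv_inj sK))/=.
under [RHS]eq_bigr do rewrite /s/= upd_upd upd_id.
rewrite -(pair_bigA _ (fun b _ => phi b))/= mulr_sumr.
by apply: eq_bigr => b _; rewrite sumr_const mulr_natl.
Qed.

(** The coordinates are transformed one at a time: [z l] has the first [l] of them
    transformed, and the matrix [Y] accumulates the transformations. *)
Lemma tensor_contraction (m : nat) (U : finType) (X : 'I_m -> U -> U -> R)
    (D E : U -> R) (C : Type) (z : nat -> {ffun 'I_m -> U} -> C -> R) :
  (forall u, 0 < D u) -> (forall u, 0 <= E u) ->
  (forall i g, \sum_b (D b)^-1 * (\sum_u X i b u * g u) ^+ 2 <=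
       \sum_u E u * g u ^+ 2) ->
  (forall (l : 'I_m) b c, z l.+1 b c = \sum_u X l (b l) u * z l (upd b l u) c) ->
  exists Y : {ffun 'I_m -> U} -> {ffun 'I_m -> U} -> R,
    (forall b c, z m b c = \sum_a Y b a * z 0%N a c) /\
    (forall g, \sum_(b : {ffun 'I_m -> U}) (\prod_i (D (b i))^-1) * (\sum_a Y b a * g a) ^+ 2 <=
       \sum_(a : {ffun 'I_m -> U}) (\prod_i E (a i)) * g a ^+ 2).
Proof.
move=> D0 E0 XDE zX.
pose w l (b : {ffun 'I_m -> U}) := \prod_(i < m) if (i < l)%N then (D (b i))^-1 else E (b i).
suff H l : (l <= m)%N -> exists Y : {ffun 'I_m -> U} -> {ffun 'I_m -> U} -> R,
    (forall b c, z l b c = \sum_a Y b a * z 0%N a c) /\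
    (forall g, \sum_b w l b * (\sum_a Y b a * g a) ^+ 2 <= \sum_(a : {ffun 'I_m -> U}) (\prod_i E (a i)) * g a ^+ 2).
  have [Y [Y1 Y2]] := H m (leqnn m); exists Y; split=> // g.
  apply: le_trans (Y2 g); apply: ler_sum => b _; rewrite ler_wpM2r ?sqr_ge0//.
  by rewrite /w le_eqVlt; apply/orP; left; apply/eqP; apply: eq_bigr => i _; rewrite ltn_ord.
elim: l => [_|l IH lm].
  exists (fun (b a : {ffun 'I_m -> U}) => (b == a)%:R).
  have pick b g : \sum_a (b == a)%:R * g a = g b :> R.
    rewrite (bigD1 b)//= eqxx mul1r big1 ?addr0// => a.
    by rewrite eq_sym => /negbTE ->; rewrite mul0r.
  split=> [b c|g]; first by rewrite pick.
  by apply: ler_sum => b _; rewrite pick.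
have [Y [Y1 Y2]] := IH (ltnW lm); pose L := Ordinal lm.
exists (fun (b a : {ffun 'I_m -> U}) => \sum_u X L (b L) u * Y (upd b L u) a).
have swap (b : {ffun 'I_m -> U}) g : \sum_a (\sum_u X L (b L) u * Y (upd b L u) a) * g a =
    \sum_u X L (b L) u * \sum_a Y (upd b L u) a * g a.
  under eq_bigr do rewrite mulr_suml.
  rewrite exchange_big/=; apply: eq_bigr => u _; rewrite mulr_sumr.
  by apply: eq_bigr => a _; rewrite mulrA.
split=> [b c|g].
  by rewrite swap (zX L); apply: eq_bigr => u _; rewrite Y1.
under eq_bigr do rewrite swap.
apply: le_trans (Y2 g).
have [U0|U0] := posnP #|U|.
  by rewrite !big1// => b _; have := card0_eq U0 (b L); rewrite inE.
rewrite -(@ler_pM2l _ #|U|%:R) ?ltr0n// !(line_sum L).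
apply: ler_sum => b _.
pose wb := \prod_(i < m | i != L) if (i < l)%N then (D (b i))^-1 else E (b i).
have wb0 : 0 <= wb.
  by apply: prodr_ge0 => i _; case: ifP => _ //; rewrite invr_ge0 ltW.
have wS u : w l.+1 (upd b L u) = wb * (D u)^-1.
  rewrite /w (bigD1 L)//= upd_same ltnSn mulrC; congr (_ * _).
  apply: eq_bigr => i iL; rewrite upd_other// ltnS leq_eqVlt.
  by rewrite (_ : (i == l :> nat) = false) //; apply: contraNF iL => /eqP il; apply/eqP/val_inj.
have wl u : w l (upd b L u) = wb * E u.
  rewrite /w (bigD1 L)//= upd_same ltnn mulrC; congr (_ * _).
  by apply: eq_bigr => i iL; rewrite upd_other.
under eq_bigr do rewrite wS upd_same -mulrA.
under [leRHS]eq_bigr do rewrite wl -mulrA.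
rewrite -!mulr_sumr ler_wpM2l//.
under eq_bigr do under eq_bigr do rewrite upd_upd.
exact: (XDE L (fun u => \sum_a Y (upd b L u) a * g a)).
Qed.

End Tensor.

(** * Contractions and exponents at least 2 *)

Section PowerSums.
Context {R : realType}.

Lemma le_powR (r x y : R) : 0 <= r -> 0 <= x -> x <= y -> x `^ r <= y `^ r.
Proof.
by move=> r0 x0 xy; apply: ge0_ler_powR; rewrite ?nnegrE// (le_trans x0).
Qed.

Lemma sum_powR_le (I : finType) (s : R) (a : I -> R) :
  1 <= s -> (forall i, 0 <= a i) -> \sum_i a i `^ s <= (\sum_i a i) `^ s.
Proof.
move=> s1 a0; have s0 : 0 < s by exact: lt_le_trans s1.
rewrite -[leRHS](mulr_powRB1 _ s0) ?sumr_ge0// mulr_suml.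
apply: ler_sum => i _; rewrite -[leLHS](mulr_powRB1 _ s0)// ler_wpM2l//.
by apply: le_powR; rewrite ?subr_ge0// (bigD1 i)//= lerDl sumr_ge0.
Qed.

(** Jensen's inequality up to a constant. The values below half the mean carry at
    most half of it, and above that threshold [x] is dominated by a multiple of
    its power [s]. *)
Lemma weighted_power_mean (I : finType) (s kap : R) (w x : I -> R) :
  1 <= s -> 0 < kap -> (forall i, 0 <= w i) -> \sum_i w i <= kap ->
  (forall i, 0 <= x i) ->
  (\sum_i w i * x i) `^ s <= (2 * kap) `^ s / kap * \sum_i w i * x i `^ s.
Proof.
move=> s1 k0 w0 wk x0; have s0 : 0 < s by exact: lt_le_trans s1.
set P := \sum_i w i * x i; set Z := \sum_i w i * _.
have P0 : 0 <= P by apply: sumr_ge0 => i _; rewrite mulr_ge0.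
have Z0 : 0 <= Z by apply: sumr_ge0 => i _; rewrite mulr_ge0// powR_ge0.
have [->|PN] := eqVneq P 0.
  by rewrite powR0 ?gt_eqF// mulr_ge0// divr_ge0 ?powR_ge0// ltW.
have Pp : 0 < P by rewrite lt_def PN.
(* Half the mean of [x], when [w] has mass [kap]. *)
pose mm := P / (2 * kap).
have m0 : 0 < mm by rewrite divr_gt0// mulr_gt0.

have PE : P = 2 * kap * mm by rewrite /mm mulrC divfK// mulf_neq0// gt_eqF.
have pt i : x i <= mm + x i `^ s * mm `^ (1 - s).
  have [xm|mx] := leP (x i) mm.
    by rewrite (le_trans xm)// lerDl mulr_ge0 ?powR_ge0.
  have xp : 0 < x i by exact: lt_trans mx.
  apply: (@le_trans _ _ (x i `^ s * mm `^ (1 - s))); last by rewrite lerDr ltW.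
  rewrite -(mulr_powRB1 (ltW xp) s0) -mulrA -[leLHS]mulr1 ler_wpM2l ?(ltW xp)//.
  rewrite -(opprB s 1) powRN ler_pdivlMr ?powR_gt0// mul1r.
  by apply: le_powR; rewrite ?subr_ge0// ltW.
have PZ : P <= kap * mm + mm `^ (1 - s) * Z.
  apply: (@le_trans _ _ (\sum_i (w i * mm + mm `^ (1 - s) * (w i * x i `^ s)))).
    apply: ler_sum => i _.
    rewrite (_ : _ + _ = w i * (mm + x i `^ s * mm `^ (1 - s))); last by ring.
    by rewrite ler_wpM2l.
  rewrite big_split/= -mulr_suml -mulr_sumr lerD2r ler_wpM2r// ltW//.
have mZ : kap * mm `^ s <= Z.
  have : kap * mm <= mm `^ (1 - s) * Z by move: PZ; rewrite {1}PE; lra.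
  rewrite -(ler_pM2l (powR_gt0 (s - 1) m0)) [X in _ <= X -> _]mulrA -powRD; last by rewrite (gt_eqF m0) implybT.
  by rewrite subrKA subrr powRr0 mul1r mulrCA [_ * mm]mulrC mulr_powRB1 // ltW.
rewrite PE powRM ?(ltW m0) ?mulr_ge0 ?(ltW k0)//.
rewrite -mulrA ler_wpM2l ?powR_ge0//.
by rewrite -(ler_pM2l k0) mulVKf ?gt_eqF.
Qed.

(** On a finite measure L_q is contained in L_2, and l_2 is contained in l_q. *)
Lemma contraction_powR (A J : finType) (Y : J -> A -> R) (eps : A -> R) (kap q : R) :
  2 <= q -> 0 < kap -> (forall a, 0 <= eps a) -> \sum_a eps a <= kap ->
  (forall g, \sum_j (\sum_a Y j a * g a) ^+ 2 <= \sum_a eps a * g a ^+ 2) ->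
  forall g, \sum_j `|\sum_a Y j a * g a| `^ q <=
    (2 * kap) `^ (q / 2) / kap * \sum_a eps a * `|g a| `^ q.
Proof.
move=> q2 k0 e0 ek YE g.
have s1 : 1 <= q / 2 by rewrite ler_pdivlMr// mul1r.
have s0 : 0 <= q / 2 by exact: le_trans s1.
have sq z : `|z| `^ q = (z ^+ 2) `^ (q / 2).
  rewrite -(real_normK (num_real z)) -(powR_mulrn 2 (normr_ge0 z)) -powRrM.
  by rewrite mulrCA divff ?mulr1// pnatr_eq0.
under eq_bigr do rewrite sq.
under [X in _ <= _ * X]eq_bigr do rewrite sq.
apply: (le_trans (sum_powR_le s1 _)) => [j|]; first exact: sqr_ge0.
apply: le_trans (weighted_power_mean s1 k0 e0 ek (fun a => sqr_ge0 (g a))).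
apply: le_powR => //; by apply: sumr_ge0 => j _; exact: sqr_ge0.
Qed.

(** The kernel [min x y] is the integral over s > 0 of the products of indicators
    1(s < x) 1(s < y), for each of which the inequality is the hypothesis. As only
    finitely many values occur, the layers are peeled off one by one, the smallest
    positive value giving the height of the next layer. *)
Lemma min_multiplier (A J : finType) (Y : J -> A -> R) (eps : A -> R) :
  (forall u v, 2 * \sum_j \sum_a Y j a * (u a * v j) <=
     \sum_a eps a * u a ^+ 2 + \sum_j v j ^+ 2) ->
  forall u v (x : A -> R) (y : J -> R),
    (forall a, 0 <= x a) -> (forall j, 0 <= y j) ->
    2 * \sum_j \sum_a Y j a * (u a * v j * Num.min (x a) (y j)) <=
    \sum_a eps a * u a ^+ 2 * x a + \sum_j v j ^+ 2 * y j.
Proof.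
move=> YE u v x y x0 y0.
pose w (i : A + J) := match i with inl a => x a | inr j => y j end.
have w0 i : 0 <= w i by case: i.
rewrite (_ : x = fun a => w (inl a))// (_ : y = fun j => w (inr j))//.
move: {x y x0 y0} w w0 => w.
have [n] := ubnP #|[pred i | 0 < w i]|.
elim: n w => // n IH w; rewrite ltnS => wn w0.
have [i0 wi0|no] := pickP [pred i | 0 < w i]; last first.
  have z i : w i = 0.
    by apply/eqP; rewrite eq_le w0 andbT leNgt; have /= -> := no i.
  rewrite !big1 ?mulr0 ?addr0// => [j _|a _|j _]; rewrite ?z ?mulr0//.
  by rewrite big1// => a _; rewrite !z minxx !mulr0.
case: (arg_minP w wi0) => i1 /= wi1 wmin.
pose mu := w i1; pose w' i := if 0 < w i then w i - mu else 0.
pose ind i : R := ((0 < w i)%R : nat)%:R.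
have wE i : w i = mu * ind i + w' i.
  rewrite /ind /w'; case: ltP => [_|wi]; first by rewrite mulr1 subrKC.
  by rewrite mulr0 addr0; apply/eqP; rewrite eq_le wi w0.
have w'0 i : 0 <= w' i.
  by rewrite /w'; case: ifP => // wi; rewrite subr_ge0; exact: wmin.
have minE a j : Num.min (w (inl a)) (w (inr j)) =
    mu * (ind (inl a) * ind (inr j)) + Num.min (w' (inl a)) (w' (inr j)).
  have [wa|wa] := ltP 0 (w (inl a)); last first.
    have wa0 : w (inl a) = 0 by apply/eqP; rewrite eq_le wa w0.
    rewrite /ind /w' wa0 ltxx mul0r mulr0 add0r !min_l//.
    by case: ifP => // wj; rewrite subr_ge0; exact: wmin.
  have [wj|wj] := ltP 0 (w (inr j)); last first.
    have wj0 : w (inr j) = 0 by apply/eqP; rewrite eq_le wj w0.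
    rewrite /ind /w' wj0 ltxx !mulr0 add0r !min_r ?(ltW wa)//.
    by rewrite wa subr_ge0; exact: wmin.
  rewrite /ind /w' wa wj !mulr1 -[X in Num.min X _](subrKC mu).
  by rewrite -[X in Num.min _ X](subrKC mu) -addr_minr ![mu + _](addrC mu) ?addrK.
have w'n : (#|[pred i | (0 < w' i)%R]| < n)%N.
  apply: leq_trans wn; apply: proper_card; apply/properP; split.
    by apply/fintype.subsetP => i; rewrite !inE /w'; case: ifP => //; rewrite ltxx.
  by exists i1; rewrite !inE// /w' wi1 subrr ltxx.
have := IH w' w'n w'0.
have := YE (fun a => u a * ind (inl a)) (fun j => v j * ind (inr j)).
have mu0 : 0 <= mu by exact: w0.
move=> /(ler_wpM2l mu0).
have ind2 i : ind i ^+ 2 = ind i.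
  by rewrite /ind; case: (_ < _); rewrite ?expr1n ?expr0n.
have -> : \sum_j \sum_a Y j a * (u a * v j * Num.min (w (inl a)) (w (inr j))) =
    mu * (\sum_j \sum_a Y j a * (u a * ind (inl a) * (v j * ind (inr j)))) +
    \sum_j \sum_a Y j a * (u a * v j * Num.min (w' (inl a)) (w' (inr j))).
  rewrite -sum2Z -sum2D; apply: eq_bigr => j _; apply: eq_bigr => a _.
  by rewrite minE; ring.
have -> : \sum_a eps a * u a ^+ 2 * w (inl a) =
    mu * (\sum_a eps a * (u a * ind (inl a)) ^+ 2) +
    \sum_a eps a * u a ^+ 2 * w' (inl a).
  rewrite mulr_sumr -big_split; apply: eq_bigr => a _ /=.
  by rewrite {1}wE exprMn ind2; ring.
have -> : \sum_j v j ^+ 2 * w (inr j) =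
    mu * (\sum_j (v j * ind (inr j)) ^+ 2) + \sum_j v j ^+ 2 * w' (inr j).
  rewrite mulr_sumr -big_split; apply: eq_bigr => j _ /=.
  by rewrite {1}wE exprMn ind2; ring.
lra.
Qed.

End PowerSums.

(** * Contractions and exponents between 1 and 2 *)

Section DualExponent.
Context {R : realType}.

(** The subtracted kernel is bounded like [sqrt (x y)] on Hilbert spaces, through
    [min_multiplier]. It equals [x^(1/p) y^(1-1/p)] when [x <= y]; when [y < x]
    the difference lies between 0 and [x^(1/p) y^(1-1/p) <= x]. *)
Lemma power_split (p x y : R) : 1 < p -> p < 2 -> 0 <= x -> 0 <= y ->
  0 <= x `^ p^-1 * y `^ (1 - p^-1) -
       (x `^ (1 - p^-1) * y `^ (1 - p^-1)) *
         Num.min (x `^ (2 / p - 1)) (y `^ (2 / p - 1)) <= x.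
Proof.
move=> p1 p2 x0 y0.
have p0 : 0 < p by lra.
have ip1 : p^-1 < 1 by rewrite invf_lt1.
have ip2 : 2^-1 < p^-1 by rewrite ltf_pV2 ?posrE//; lra.
have e0 : 0 < 2 / p - 1 by lra.
have -> : x `^ p^-1 = x `^ (1 - p^-1) * x `^ (2 / p - 1).
  rewrite -powRD; first by congr (_ `^ _); lra.
  by rewrite (_ : _ + _ = p^-1) ?invr_eq0 ?(gt_eqF p0)//; lra.
rewrite mulrAC -mulrBr.
have [xy|yx] := leP (x `^ (2 / p - 1)) (y `^ (2 / p - 1)).
  by rewrite subrr mulr0 lexx.
have yx' : y <= x.
  rewrite leNgt; apply/negP => /ltW xy; move: yx; rewrite ltNge.
  by rewrite le_powR// ltW.
apply/andP; split.
  by rewrite mulr_ge0 ?mulr_ge0 ?powR_ge0// subr_ge0 ltW.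
apply: (@le_trans _ _ (x `^ (1 - p^-1) * x `^ (1 - p^-1) * x `^ (2 / p - 1))).
  apply: ler_pM; rewrite ?mulr_ge0 ?powR_ge0 ?subr_ge0 ?(ltW yx)//.
    by rewrite ler_wpM2l ?powR_ge0// le_powR// subr_ge0 ltW.
  by rewrite lerBlDr lerDl powR_ge0.
have xn : x != 0.
  by apply: contraTneq yx => ->; rewrite powR0 ?gt_eqF// -leNgt powR_ge0.
rewrite -!powRD ?xn ?implybT//.
by rewrite (_ : 1 - p^-1 + (1 - p^-1) + (2 / p - 1) = 1) ?powRr1//; lra.
Qed.

(** Test the contraction on the signs of a row. *)
Lemma contraction_row_bound (A J : finType) (Y : J -> A -> R) (eps : A -> R) (kap : R) :
  1 <= kap -> (forall a, 0 <= eps a) -> \sum_a eps a <= kap ->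
  (forall g, \sum_j (\sum_a Y j a * g a) ^+ 2 <= \sum_a eps a * g a ^+ 2) ->
  forall j, \sum_a `|Y j a| <= kap.
Proof.
move=> k1 e0 ek YE j.
have s0 : 0 <= \sum_a `|Y j a| by apply: sumr_ge0.
rewrite -(@ler_pXn2r _ 2)// ?nnegrE//; last by lra.
apply: (@le_trans _ _ kap); last by rewrite expr2; nra.
have := YE (fun a => Num.sg (Y j a)).
rewrite (bigD1 j)//=.
under eq_bigr do rewrite mulrC -normrEsg.
have : \sum_a eps a * Num.sg (Y j a) ^+ 2 <= \sum_a eps a.
  apply: ler_sum => a _; rewrite -[leRHS]mulr1 ler_wpM2l//.
  by rewrite sqr_sg lern1 leq_b1.
have : 0 <= \sum_(i | i != j) (\sum_a Y i a * Num.sg (Y j a)) ^+ 2.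
  by apply: sumr_ge0 => i _; exact: sqr_ge0.
move: ek; lra.
Qed.

(** Put [S j = |F j|_p^p] and [r = 1 / (p - 1)], so that the left-hand side is
    [Q = sum_j (S j)^r]. Pairing each [F j] with the functional that norms it
    writes [Q] as a sum of the [Y j a] against the kernel of [power_split], with
    [x = |f|^p] and [y] a multiple of [|F j|^p]. The Hilbert part is controlled by
    [min_multiplier] and the remainder by [contraction_row_bound], each by a
    fraction of [Q] plus a constant, and the fractions add up to less than 1. *)
Lemma contraction_dual_exponent (A J C : finType) (Y : J -> A -> R)
    (eps : A -> R) (kap p : R) (f : A -> C -> R) :
  1 < p -> p < 2 -> 1 <= kap -> (forall a, 0 <= eps a) -> \sum_a eps a <= kap ->
  (forall g, \sum_j (\sum_a Y j a * g a) ^+ 2 <= \sum_a eps a * g a ^+ 2) ->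
  (forall a, \sum_c `|f a c| `^ p <= 1) ->
  \sum_j (\sum_c `|\sum_a Y j a * f a c| `^ p) `^ (p - 1)^-1 <=
    4 * kap * (2 * kap) `^ ((p - 1)^-1 - 1).
Proof.
move=> p1 p2 k1 e0 ek YE f1.
have k0 : 0 < kap by lra.
have p0 : 0 < p by lra.
have q0 : 0 < p - 1 by lra.
have ip1 : p^-1 < 1 by rewrite invf_lt1.
have ip2 : 2^-1 < p^-1 by rewrite ltf_pV2 ?posrE//; lra.
have pp : p * p^-1 = 1 by rewrite divff// gt_eqF.
pose r := (p - 1)^-1; pose L := 2 * kap; pose e := 2 / p - 1; pose ip' := 1 - p^-1.
have qr : (p - 1) * r = 1 by rewrite divff// gt_eqF.
have r1 : 1 < r by rewrite -(ltr_pM2l q0) qr; lra.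
have ip'0 : 0 < ip' by rewrite /ip'; lra.
have ipr : (1 + r) * ip' = 1.
  rewrite /ip' /r; field; rewrite !gt_eqF//=; lra.
have pip : p * ip' = p - 1 by rewrite /ip' mulrBr pp mulr1.
have L0 : 0 < L by rewrite /L; lra.
pose F j c := \sum_a Y j a * f a c; pose S j := \sum_c `|F j c| `^ p.
rewrite -/r -/L.
have LE : L = 2 * kap by [].
clearbody L.
have S0 j : 0 <= S j by apply: sumr_ge0 => c _; exact: powR_ge0.
pose Q := \sum_j S j `^ r.
suff : Q <= 4 * kap * L `^ (r - 1) by [].
pose be j := S j `^ r / L.
have be0 j : 0 <= be j by rewrite divr_ge0 ?powR_ge0// ltW.
pose x a c := `|f a c| `^ p.
(* With this [y], [be j * y j c ^ (1 - 1/p)] is [S j ^ (r - 1) * |F j c| ^ (p - 1)],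
   the functional norming [F j]; see [by_]. *)
pose y j c := L `^ (1 + r) * `|F j c| `^ p * S j `^ (- (1 + r)).
have x0 a c : 0 <= x a c by exact: powR_ge0.
have y0 j c : 0 <= y j c by rewrite /y !mulr_ge0 ?powR_ge0.
pose M j a c := x a c `^ ip' * y j c `^ ip' * Num.min (x a c `^ e) (y j c `^ e).
pose K a j c := x a c `^ p^-1 * y j c `^ ip'.
have KM a j c : 0 <= K a j c - M j a c <= x a c by exact: power_split.
have xf a c : x a c `^ p^-1 = `|f a c| by rewrite /x -powRrM pp powRr1.
have S_eq0 j c : S j = 0 -> F j c = 0.
  move=> /eqP; rewrite psumr_eq0; last by move=> *; exact: powR_ge0.
  by move=> /allP/(_ c (mem_index_enum c))/=; rewrite powR_eq0 normr_eq0 => /andP[/eqP].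
have by_ j c : be j * y j c `^ ip' = S j `^ (r - 1) * `|F j c| `^ (p - 1).
  have [Sj|Sj] := eqVneq (S j) 0.
    by rewrite /be (S_eq0 _ c Sj) Sj normr0 !powR0 ?gt_eqF ?mul0r ?mulr0//; lra.
  have Sp : 0 < S j by rewrite lt_def Sj S0.
  rewrite /y !powRM ?mulr_ge0 ?powR_ge0// -!powRrM ipr mulNr ipr pip.
  rewrite powRr1 ?(ltW L0)// powR_inv1// [S j `^ (r - 1)]powRB ?Sj ?implybT// powRr1//.
  by rewrite /be; field; rewrite Sj gt_eqF.
pose s a c := Num.sg (f a c); pose sg j c := Num.sg (F j c).
have QE : Q = \sum_j \sum_a Y j a * \sum_c s a c * sg j c * (be j * K a j c).
  apply: eq_bigr => j _.
  transitivity (S j `^ (r - 1) * \sum_c F j c * (sg j c * `|F j c| `^ (p - 1))).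
    rewrite -[LHS]mulr_powRB1//; last by lra.
    rewrite mulrC; congr (_ * _); apply: eq_bigr => c _.
    by rewrite mulrA [F j c * _]mulrC -normrEsg mulr_powRB1.
  rewrite mulr_sumr.
  transitivity (\sum_c \sum_a Y j a * (s a c * sg j c * (be j * K a j c))).
    apply: eq_bigr => c _; rewrite /F mulr_suml mulr_sumr; apply: eq_bigr => a _.
    rewrite /K xf -/(F j c) [be j * _]mulrCA by_ {1}(numEsg (f a c)) -/(s a c); ring.
  rewrite exchange_big; apply: eq_bigr => a _; by rewrite mulr_sumr.
have sgn1 (z : R) : `|Num.sg z| <= 1 by rewrite normr_sg lern1 leq_b1.
have sgn2 (z : R) : Num.sg z ^+ 2 <= 1 by rewrite sqr_sg lern1 leq_b1.
pose Q1 := \sum_j \sum_a Y j a * \sum_c s a c * sg j c * (be j * (K a j c - M j a c)).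
pose Q2 := \sum_j \sum_a Y j a * \sum_c s a c * sg j c * (be j * M j a c).
have QD : Q = Q1 + Q2.
  rewrite QE /Q1 /Q2 -sum2D; apply: eq_bigr => j _; apply: eq_bigr => a _.
  rewrite -mulrDr -big_split; congr (_ * _); apply: eq_bigr => c _ /=; ring.
have Q1b : Q1 <= Q / 2.
  have -> : Q / 2 = \sum_j be j * kap.
    by rewrite /Q mulr_suml; apply: eq_bigr => j _; rewrite /be LE; field; rewrite gt_eqF.
  apply: ler_sum => j _.
  apply: (@le_trans _ _ (be j * \sum_a `|Y j a|)); last first.
    by rewrite ler_wpM2l//; exact: contraction_row_bound YE j.
  rewrite mulr_sumr; apply: ler_sum => a _.
  rewrite (le_trans (ler_norm _))// normrM mulrC ler_wpM2r//.
  apply: (le_trans (ler_norm_sum _ _ _)).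
  apply: (@le_trans _ _ (\sum_c be j * x a c)); last first.
    by rewrite -mulr_sumr -[leRHS]mulr1 ler_wpM2l//; exact: f1.
  apply: ler_sum => c _; have /andP[K0 Kx] := KM a j c.
  rewrite normrM [ `|be j * _| ]normrM (ger0_norm (be0 j)) (ger0_norm K0).
  rewrite -[leRHS]mul1r; apply: ler_pM => //; first by rewrite mulr_ge0.
    by rewrite normrM mulr_ile1//; exact: sgn1.
  by rewrite ler_wpM2l.
(* The two terms of [min_multiplier] are balanced by [la] so that the second one
   becomes [Q / 2]. *)
pose la := 2 * L `^ (r - 1).
have la0 : 0 < la by rewrite mulr_gt0 ?powR_gt0.
have YA u v : 2 * \sum_j \sum_a Y j a * (u a * v j) <=
     \sum_a eps a * u a ^+ 2 + \sum_j v j ^+ 2.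
  apply: le_trans (lerD (YE u) (lexx _)).
  rewrite -big_split mulr_sumr; apply: ler_sum => j _ /=.
  under eq_bigr do rewrite mulrA; rewrite -mulr_suml.
  have := sqr_ge0 (\sum_a Y j a * u a - v j); lra.
have xe a c : (x a c `^ ip') ^+ 2 * x a c `^ e = x a c.
  have [->|xn] := eqVneq (x a c) 0; first by rewrite !powR0 ?gt_eqF ?mulr0//; rewrite /e; lra.
  rewrite expr2 -!powRD ?xn ?implybT// (_ : ip' + ip' + e = 1) ?powRr1//.
  by rewrite /ip' /e; lra.
have ye j c : (y j c `^ ip') ^+ 2 * y j c `^ e = y j c.
  have [->|xn] := eqVneq (y j c) 0; first by rewrite !powR0 ?gt_eqF ?mulr0//; rewrite /e; lra.
  rewrite expr2 -!powRD ?xn ?implybT// (_ : ip' + ip' + e = 1) ?powRr1//.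
  by rewrite /ip' /e; lra.
have Q2b : 2 * Q2 <= la * kap + la^-1 * (L `^ (r - 1) * Q).
  have Q2c c : 2 * \sum_j \sum_a Y j a * (s a c * sg j c * (be j * M j a c)) <=
      la * (\sum_a eps a * x a c) + la^-1 * \sum_j be j ^+ 2 * y j c.
    have := min_multiplier YA (fun a => s a c * x a c `^ ip')
      (fun j => la^-1 * (sg j c * be j * y j c `^ ip'))
      (fun a => powR_ge0 (x a c) e) (fun j => powR_ge0 (y j c) e).
    move=> H; rewrite -(ler_pM2l (_ : 0 < la^-1)) ?invr_gt0//.
    rewrite mulrDr mulKf ?gt_eqF//.
    apply: le_trans (le_trans H _).
      rewrite mulrCA -sum2Z ler_wpM2l// ler_sum// => j _; rewrite ler_sum// => a _.
      by rewrite /M le_eqVlt; apply/orP; left; apply/eqP; ring.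
    apply: lerD.
      apply: ler_sum => a _; rewrite -mulrA ler_wpM2l// exprMn -mulrA xe.
      by rewrite -[leRHS]mul1r ler_wpM2r//; exact: sgn2.
    rewrite !mulr_sumr; apply: ler_sum => j _.
    rewrite !exprMn -[in leRHS](ye j c).
    pose Z := la^-1 ^+ 2 * be j ^+ 2 * (y j c `^ ip') ^+ 2 * y j c `^ e.
    rewrite [leRHS](_ : _ = 1 * Z); last by rewrite /Z /be; ring.
    rewrite [leLHS](_ : _ = sg j c ^+ 2 * Z); last by rewrite /Z /be; ring.
    apply: ler_wpM2r; last exact: sgn2.
    apply: mulr_ge0; last exact: powR_ge0.
    apply: mulr_ge0; last exact: sqr_ge0.
    by apply: mulr_ge0; exact: sqr_ge0.
  have -> : Q2 = \sum_c \sum_j \sum_a Y j a * (s a c * sg j c * (be j * M j a c)).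
    rewrite exchange_big; apply: eq_bigr => j _ /=.
    by rewrite exchange_big; apply: eq_bigr => a _ /=; rewrite mulr_sumr.
  rewrite mulr_sumr; apply: (le_trans (ler_sum _ (fun c _ => Q2c c))).
  rewrite big_split/= -!mulr_sumr; apply: lerD.
    rewrite ler_wpM2l ?(ltW la0)// exchange_big/=; apply: le_trans ek.
    by apply: ler_sum => a _; rewrite -mulr_sumr -[leRHS]mulr1 ler_wpM2l//; exact: f1.
  rewrite ler_wpM2l ?invr_ge0 ?(ltW la0)// exchange_big/= mulr_sumr; apply: ler_sum => j _.
  rewrite -mulr_sumr -mulr_suml -mulr_sumr -/(S j).
  have [Sj|Sj] := eqVneq (S j) 0.
    have z : S j `^ r = 0 by rewrite Sj powR0// gt_eqF//; lra.
    by rewrite /be z mul0r expr0n/= mul0r mulr0.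
  have Ln : L != 0 by rewrite gt_eqF.
  have eL1 : L `^ (1 + r) = L * L `^ r by rewrite powRD ?Ln ?implybT// powRr1// ltW.
  have eL2 : L `^ (r - 1) = L `^ r / L by rewrite powRB ?Ln ?implybT// powRr1// ltW.
  have eS : S j `^ (- (1 + r)) = (S j * S j `^ r)^-1.
    by rewrite powRN powRD ?Sj ?implybT// powRr1.
  rewrite eL1 eL2 eS.
  rewrite /be le_eqVlt; apply/orP; left; apply/eqP.
  by field; rewrite Ln Sj powR_eq0 (negbTE Sj).
have Q0 : 0 <= Q by apply: sumr_ge0 => j _; exact: powR_ge0.
have laQ : la^-1 * (L `^ (r - 1) * Q) = Q / 2.
  by rewrite /la; field; rewrite gt_eqF// powR_gt0.
move: Q2b; rewrite laQ /la; move: Q1b QD.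
set z := L `^ (r - 1); nra.
Qed.
End DualExponent.

(** * Sums over diagonals *)

Section DiagonalSums.
Context {R : realType}.

(** The decidable counterpart of [diagonal_indices]. *)
Definition on_diagonals (m : nat) (I : {set {set 'I_m}}) (U : eqType) (b : {ffun 'I_m -> U}) :=
  [forall B in I, [forall a in B, [forall c in B, b a == b c]]].

Lemma on_diagonalsP (m : nat) (I : {set {set 'I_m}}) (U : eqType) (b : {ffun 'I_m -> U}) :
  reflect (forall B, B \in I -> {in B &, forall a c, b a = b c}) (on_diagonals I b).
Proof.
apply: (iffP forallP) => [H B BI a c aB cB|H B].
  move: (H B) => /implyP/(_ BI)/forallP/(_ a)/implyP/(_ aB)/forallP/(_ c)/implyP/(_ cB).
  by move/eqP.
apply/implyP => BI; apply/forallP => a; apply/implyP => aB.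
by apply/forallP => c; apply/implyP => cB; apply/eqP; apply: (H B).
Qed.

Lemma ler_sum_inj (S S' : finType) (P : pred S) (Q : pred S') (h : S -> S')
    (G : S' -> R) :
  {in P &, injective h} -> (forall s, P s -> Q (h s)) -> (forall s, 0 <= G s) ->
  \sum_(s | P s) G (h s) <= \sum_(s | Q s) G s.
Proof.
move=> hinj hQ G0.
pose A := finset P.
have -> : \sum_(s | P s) G (h s) = \sum_(s in A) G (h s).
  by apply: eq_bigl => s; rewrite inE.
rewrite -(big_imset G (h := h) (A := mem A))/=; last first.
  by move=> s s'; rewrite !inE => sP s'P; apply: hinj.
rewrite [leRHS](bigID (mem (h @: A)%SET))/=.
rewrite (_ : \sum_(i in _) _ = \sum_(i | Q i && (i \in (h @: A)%SET)) G i).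
  by rewrite lerDl sumr_ge0.
apply: eq_bigl => s'; apply/esym/andb_idl => /imsetP[s + ->].
by rewrite inE => /hQ.
Qed.

Lemma min_block_card_le (m : nat) (I : {set {set 'I_m}}) B :
  B \in I -> (min_block_card I <= #|B|)%N.
Proof.
move=> BI; rewrite /min_block_card; have := mem_index_enum B.
elim: (index_enum _) => // A r IH; rewrite inE big_cons => /predU1P[<-|Br].
  by rewrite BI geq_minl.
by case: ifP => _; rewrite ?geq_min IH ?orbT.
Qed.

Lemma min_block_card_gt0 (m : nat) (I : {set {set 'I_m}}) :
  (0 < m)%N -> finset.partition I [set: 'I_m]%SET -> (0 < min_block_card I)%N.
Proof.
move=> m0 /and3P[_ _ I0]; rewrite /min_block_card.
apply: (big_ind (fun k => 0 < k)%N) => // [x y x0 y0|B BI]; first by rewrite leq_min x0.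
by rewrite card_gt0; apply: contraNneq I0 => <-.
Qed.

(** Let [n] be the least block cardinal. On the diagonals a block [B] contributes
    [D^(|B| / n) <= D], because [D <= 1] and [n <= |B|]. One free index per block
    remains, and the sum factors into powers of the mass of [D]. *)
Lemma diagonal_weight_sum (m : nat) (I : {set {set 'I_m}}) (U : finType) (D : U -> R) :
  (0 < m)%N -> finset.partition I [set: 'I_m]%SET ->
  (forall u, 0 < D u) -> \sum_u D u <= 1 ->
  \sum_(b : {ffun 'I_m -> U} | on_diagonals I b)
    \prod_i D (b i) `^ (min_block_card I)%:R^-1 <= 1.
Proof.
move=> m0 Ipart D0 D1; set n := min_block_card I.
have n0 : (0 < n)%N by exact: min_block_card_gt0.
case: (pickP U) => [u0 _|U0]; last first.
  rewrite big_pred0// => b; have := U0 (b (Ordinal m0)); by [].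
have Dle1 u : D u <= 1.
  by apply: le_trans D1; rewrite (bigD1 u)//= lerDl sumr_ge0// => v _; exact: ltW.
pose rep (B : {set 'I_m}) : 'I_m := odflt (Ordinal m0) [pick i in B].
have I0 B : B \in I -> rep B \in B.
  move=> BI; rewrite /rep; case: pickP => //= B0.
  have [_ _ /negP[]] := and3P Ipart.
  by rewrite (_ : finset.set0 = B)//; apply/setP => i; rewrite inE B0.
pose h (b : {ffun 'I_m -> U}) : {ffun {set 'I_m} -> U} :=
  [ffun B => if B \in I then b (rep B) else u0].
apply: (@le_trans _ _ (\sum_(b : {ffun 'I_m -> U} | on_diagonals I b)
    \prod_(B in I) D (h b B))).
  apply: ler_sum => b /on_diagonalsP bI.
  rewrite (eq_bigl (mem [set: 'I_m]%SET)) => [|i]; last by rewrite /= finset.in_setT.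
  rewrite (set_partition_big _ Ipart)/=.
  apply: ler_prod => B BI; apply/andP; split; first by apply: prodr_ge0 => i _; exact: powR_ge0.
  rewrite ffunE BI.
  rewrite (eq_bigr (fun=> D (b (rep B)) `^ n%:R^-1)) => [|i iB]; last first.
    by rewrite (bI B BI i (rep B))// I0.
  rewrite prodr_const -powR_mulrn ?powR_ge0// -powRrM.
  apply: ge1r_powR; first by rewrite D0 Dle1.
  by rewrite ler_pdivlMl ?ltr0n// mulr1 ler_nat; exact: min_block_card_le.
apply: (@le_trans _ _ (\sum_(g in pffun_on u0 (mem I) predT) \prod_(B in I) D (g B))).
  apply: (@ler_sum_inj {ffun 'I_m -> U} {ffun {set 'I_m} -> U} (fun b => on_diagonals I b)
    (fun g => g \in pffun_on u0 (mem I) predT) h (fun g => \prod_(B in I) D (g B))) => [b b' bI b'I hE|b _|g].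
  - apply/ffunP => i; have iI : i \in finset.cover I by rewrite (finset.cover_partition Ipart) finset.in_setT.
    have [B BI iB] := finset.bigcupP iI.
    have := congr1 (fun g : {ffun {set 'I_m} -> U} => g B) hE; rewrite !ffunE BI.
    move/on_diagonalsP: bI => /(_ B BI i (rep B) iB (I0 B BI)) ->.
    by move/on_diagonalsP: b'I => /(_ B BI i (rep B) iB (I0 B BI)) ->.
  - apply/pffun_onP; split=> //; apply/fintype.subsetP => B.
    by rewrite inE ffunE; case: ifP => //; rewrite eqxx.
  - by apply: prodr_ge0 => B _; exact: ltW.
rewrite -(big_distr_big u0 (mem I) predT (fun _ u => D u))/=.
rewrite prodr_const exprn_ile1// sumr_ge0// => u _; exact: ltW.
Qed.

Lemma powR_prod (J : finType) (F : J -> R) (r : R) : (forall j, 0 <= F j) ->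
  (\prod_j F j) `^ r = \prod_j F j `^ r.
Proof.
move=> F0; suff [] : 0 <= \prod_j F j /\ (\prod_j F j) `^ r = \prod_j F j `^ r by [].
elim/big_rec2: _ => [|j x y _ [y0 <-]]; first by rewrite powR1.
by rewrite mulr_ge0// powRM.
Qed.

Lemma powR_mul_le_add (x y al be : R) : 0 <= x -> 0 <= y -> 0 <= al -> 0 <= be ->
  al + be = 1 -> x `^ al * y `^ be <= x + y.
Proof.
move=> x0 y0 al0 be0 ab.
have abn : al + be != 0 by rewrite ab oner_eq0.
have [xy|/ltW yx] := leP x y.
  apply: (@le_trans _ _ (y `^ al * y `^ be)).
    by rewrite ler_wpM2r ?powR_ge0// le_powR.
  by rewrite -powRD ?(negbTE abn)// ab powRr1// lerDr.
apply: (@le_trans _ _ (x `^ al * x `^ be)).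
  by rewrite ler_wpM2l ?powR_ge0// le_powR.
by rewrite -powRD ?(negbTE abn)// ab powRr1// lerDl.
Qed.

(** Let [P] be the product of the [D (b i)] and [n] the least block cardinal. The
    summand is [(h^q)^(t / q) (P^(1 / n))^(t n / 2)] with exponents of sum 1, so it
    is at most [h^q + P^(1 / n)]. *)
Lemma diagonal_power_sum (m : nat) (I : {set {set 'I_m}}) (U : finType) (D : U -> R)
    (q t K : R) (h : {ffun 'I_m -> U} -> R) :
  (0 < m)%N -> finset.partition I [set: 'I_m]%SET ->
  (forall u, 0 < D u) -> \sum_u D u <= 1 ->
  0 < q -> 0 < t -> t * ((min_block_card I)%:R / 2 + q^-1) = 1 ->
  (forall b, 0 <= h b) -> \sum_b h b `^ q <= K ->
  \sum_(b : {ffun 'I_m -> U} | on_diagonals I b)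
    (h b * Num.sqrt (\prod_i D (b i))) `^ t <= K + 1.
Proof.
move=> m0 Ipart D0 D1 q0 t0 tq h0 hK.
have n0 : (0 < min_block_card I)%N by exact: min_block_card_gt0.
have := diagonal_weight_sum m0 Ipart D0 D1.
set n : R := (min_block_card I)%:R in tq *.
have np : 0 < n by rewrite ltr0n.
move=> Dn; apply: le_trans (lerD hK Dn).
apply: (@le_trans _ _ (\sum_(b : {ffun 'I_m -> U} | on_diagonals I b)
   (h b `^ q + \prod_i D (b i) `^ n^-1))); last first.
  rewrite big_split/= lerD2r [leRHS](bigID (fun b => on_diagonals I b))/= lerDl.
  by apply: sumr_ge0 => b _; exact: powR_ge0.
apply: ler_sum => b _.
have P0 : 0 <= \prod_i D (b i) by apply: prodr_ge0 => i _; exact: ltW.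
rewrite -powR_prod => [|i]; last exact: ltW.
rewrite powRM ?sqrtr_ge0// -powR12_sqrt// -powRrM.
rewrite (_ : t = q * (t / q)); last by rewrite mulrC divfK// gt_eqF.
rewrite powRrM (_ : 2^-1 * _ = n^-1 * (t * n / 2)); last first.
  by field; rewrite !gt_eqF.
rewrite [X in _ * X]powRrM; apply: powR_mul_le_add; rewrite ?powR_ge0//.
- by rewrite divr_ge0// ltW.
- by rewrite divr_ge0// ?mulr_ge0// ltW.
- by transitivity (t * (n / 2 + q^-1)) => //; ring.
Qed.

Lemma prod_sqrt (J : finType) (F : J -> R) : (forall j, 0 <= F j) ->
  \prod_j Num.sqrt (F j) = Num.sqrt (\prod_j F j).
Proof.
move=> F0; rewrite -powR12_sqrt ?prodr_ge0// powR_prod//.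
by apply: eq_bigr => j _; rewrite powR12_sqrt.
Qed.

(** Square summability of the norms of a weakly summable sequence in l_1: test the
    contraction on the signs of a row. *)
Lemma weights_row_bound (U : finType) (X : U -> U -> R) (D E : U -> R) (kap : R) :
  (forall u, 0 < D u) -> (forall u, 0 <= E u) -> \sum_u E u <= kap ->
  (forall g, \sum_b (D b)^-1 * (\sum_u X b u * g u) ^+ 2 <= \sum_u E u * g u ^+ 2) ->
  forall b, \sum_u `|X b u| <= Num.sqrt kap * Num.sqrt (D b).
Proof.
move=> D0 E0 Ek XDE b.
have k0 : 0 <= kap by apply: le_trans Ek; exact: sumr_ge0.
have s0 : 0 <= \sum_u `|X b u| by apply: sumr_ge0.
rewrite -sqrtrM// -[leLHS]ger0_norm// -sqrtr_sqr ler_wsqrtr//.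
rewrite -ler_pdivrMr// mulrC.
have := XDE (fun u => Num.sg (X b u)).
rewrite (bigD1 b)//=.
under eq_bigr do rewrite mulrC -normrEsg.
have : \sum_u E u * Num.sg (X b u) ^+ 2 <= \sum_u E u.
  apply: ler_sum => a _; rewrite -[leRHS]mulr1 ler_wpM2l//.
  by rewrite sqr_sg lern1 leq_b1.
have : 0 <= \sum_(i | i != b) (D i)^-1 * (\sum_a X i a * Num.sg (X b a)) ^+ 2.
  by apply: sumr_ge0 => i _; rewrite mulr_ge0 ?sqr_ge0// invr_ge0 ltW.
move: Ek; lra.
Qed.

(** The case of exponent [2 / n], which uses only the norms of the vectors. *)
Lemma endpoint_sum (m : nat) (I : {set {set 'I_m}}) (W : R) :
  (0 < m)%N -> finset.partition I [set: 'I_m]%SET -> 0 <= W ->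
  exists K : R, forall (U : finType) (X : 'I_m -> U -> U -> R) (N : {ffun 'I_m -> U} -> R),
    (forall i, bilinear_bound (X i) W) ->
    (forall b, 0 <= N b <= \prod_i \sum_u `|X i (b i) u|) ->
    \sum_(b : {ffun 'I_m -> U} | on_diagonals I b)
      N b `^ (2 / (min_block_card I)%:R) <= K.
Proof.
move=> m0 Ipart W0.
have n0 : (0 < min_block_card I)%N by exact: min_block_card_gt0.
set n : R := (min_block_card I)%:R; have np : 0 < n by rewrite ltr0n.
set kap := (m%:R * (8 * W + 1) + 1) ^+ 2.
exists ((Num.sqrt kap ^+ m) `^ (2 / n)) => U X N XW NX.
have [D [E [D0 D1 E0 Ek XDE]]] := common_weights W0 XW.
have Dn := diagonal_weight_sum m0 Ipart D0 D1.
rewrite -[leRHS]mulr1; apply: le_trans (ler_wpM2l (powR_ge0 _ _) Dn).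
rewrite mulr_sumr; apply: ler_sum => b _.
have P0 : 0 <= \prod_i D (b i) by apply: prodr_ge0 => i _; exact: ltW.
rewrite -powR_prod => [|i]; last exact: ltW.
rewrite [X in _ <= _ * _ `^ X](_ : _ = 2^-1 * (2 / n)); last by field; rewrite gt_eqF.
rewrite [(\prod_i D (b i)) `^ _]powRrM powR12_sqrt//.
rewrite -powRM ?sqrtr_ge0 ?exprn_ge0 ?sqrtr_ge0//.
have /andP[Nb0 Nb] := NX b.
apply: le_powR => //; first by rewrite divr_ge0// ltW.
apply: (le_trans Nb); rewrite -prod_sqrt => [|i]; last exact: ltW.
have -> : Num.sqrt kap ^+ m = \prod_(i < m) Num.sqrt kap by rewrite prodr_const card_ord.
rewrite -big_split/=.
apply: ler_prod => i _; rewrite sumr_ge0//=.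
exact: (weights_row_bound D0 E0 Ek (XDE i)).
Qed.

End DiagonalSums.

(** * The finite estimate for 1 < p < oo *)

Section Interior.
Context {R : realType}.

(** The family [z] leads from the values of a multilinear map on basis vectors,
    [z 0], to its values on the given vectors, [z m], one variable at a time. *)
Lemma interior_sum (m : nat) (I : {set {set 'I_m}}) (W p q t : R) :
  (0 < m)%N -> finset.partition I [set: 'I_m]%SET -> 0 <= W ->
  1 < p -> q = (if p < 2 then p / (p - 1) else p) ->
  0 < t -> t * ((min_block_card I)%:R / 2 + q^-1) = 1 ->
  exists K : R, forall (U C : finType) (X : 'I_m -> U -> U -> R)
      (z : nat -> {ffun 'I_m -> U} -> C -> R),
    (forall i, bilinear_bound (X i) W) ->
    (forall (l : 'I_m) b c, z l.+1 b c = \sum_u X l (b l) u * z l (upd b l u) c) ->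
    (forall a, \sum_c `|z 0%N a c| `^ p <= 1) ->
    \sum_(b : {ffun 'I_m -> U} | on_diagonals I b)
      ((\sum_c `|z m b c| `^ p) `^ p^-1) `^ t <= K.
Proof.
move=> m0 Ipart W0 p1 qE t0 tq.
have p0 : 0 < p by lra.
have q0 : 0 < q by rewrite qE; case: ifP => _ //; rewrite divr_gt0//; lra.
set kap0 := (m%:R * (8 * W + 1) + 1) ^+ 2.
have k01 : 1 <= kap0.
  rewrite /kap0 exprn_ege1// -lerBlDr subrr mulr_ge0//; lra.
pose kap := kap0 ^+ m.
have k1 : 1 <= kap by exact: exprn_ege1.
have k0 : 0 < kap by lra.
pose K1 := if p < 2 then 4 * kap * (2 * kap) `^ ((p - 1)^-1 - 1)
  else (2 * kap) `^ (p / 2) / kap * kap.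
exists (K1 + 1) => U C X z XW zX z1.
have [D [E [D0 D1 E0 Ek XDE]]] := common_weights W0 XW.
have [Y [zY YE]] := tensor_contraction D0 E0 XDE zX.
pose f := z 0%N.
pose eps (a : {ffun 'I_m -> U}) := \prod_i E (a i).
have e0 a : 0 <= eps a by exact: prodr_ge0.
have ek : \sum_a eps a <= kap.
  rewrite /eps -(bigA_distr_bigA (fun _ u => E u))/= prodr_const card_ord.
  by rewrite lerXn2r ?nnegrE ?sumr_ge0// (le_trans _ k01).
pose om (b : {ffun 'I_m -> U}) := \prod_i (D (b i))^-1.
have om0 b : 0 < om b by apply: prodr_gt0 => i _; rewrite invr_gt0.
pose Y' b a := Num.sqrt (om b) * Y b a.
have Y'E b g : \sum_a Y' b a * g a = Num.sqrt (om b) * \sum_a Y b a * g a.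
  by rewrite mulr_sumr; apply: eq_bigr => a _; rewrite mulrA.
have Y'c g : \sum_b (\sum_a Y' b a * g a) ^+ 2 <= \sum_a eps a * g a ^+ 2.
  apply: le_trans (YE g); apply: ler_sum => b _.
  by rewrite Y'E exprMn sqr_sqrtr// ltW.
pose S b := \sum_c `|\sum_a Y' b a * f a c| `^ p.
pose h b := S b `^ p^-1.
have S0 b : 0 <= S b by apply: sumr_ge0 => c _; exact: powR_ge0.
have sumh : \sum_b h b `^ q <= K1.
  rewrite /h; under eq_bigr do rewrite -powRrM.
  rewrite /K1; case: ifPn qE => [p2 ->|p2 ->].
    rewrite mulrA mulVf ?gt_eqF// mul1r.
    exact: contraction_dual_exponent.
  rewrite -leNgt in p2.
  under eq_bigr do rewrite mulVf ?gt_eqF// powRr1//.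
  rewrite /S exchange_big/=.
  apply: le_trans (ler_sum _ (fun c _ => contraction_powR p2 k0 e0 ek Y'c (fun a => f a c))) _.
  rewrite -mulr_sumr ler_wpM2l ?divr_ge0 ?powR_ge0 ?(ltW k0)//.
  rewrite exchange_big/=; apply: le_trans ek; apply: ler_sum => a _.
  by rewrite -mulr_sumr -[leRHS]mulr1 ler_wpM2l//; exact: z1.
have := diagonal_power_sum m0 Ipart D0 D1 q0 t0 tq (fun b => powR_ge0 _ _) sumh.
apply: le_trans; rewrite le_eqVlt; apply/orP; left; apply/eqP.
apply: eq_bigr => b _; congr (_ `^ _).
have P0 : 0 < \prod_i D (b i) by apply: prodr_gt0.
have omE : Num.sqrt (om b) * Num.sqrt (\prod_i D (b i)) = 1.
  by rewrite -sqrtrM ?(ltW (om0 b))// /om prodfV mulVf ?sqrtr1// gt_eqF.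
rewrite /h /S.
have E1 c : `|\sum_a Y' b a * f a c| `^ p = Num.sqrt (om b) `^ p * `|z m b c| `^ p.
  rewrite (Y'E b (fun a => f a c)) /f -zY normrM.
  by rewrite (ger0_norm (sqrtr_ge0 _)) powRM ?sqrtr_ge0.
rewrite (eq_bigr _ (fun c _ => E1 c)).
rewrite -mulr_sumr powRM ?powR_ge0 ?sumr_ge0//.
rewrite -powRrM mulfV ?gt_eqF// powRr1 ?sqrtr_ge0//.
by rewrite mulrAC omE mul1r.
Qed.
End Interior.

(** * Real coordinates of real and complex scalars *)

Section ScalarCoordinates.
Context {R : realType} {s : scalar_kind}.
Local Notation K := (scalars R s).

Definition imag_of : K -> R :=
  match s with
  | RealScalars => fun=> 0
  | ComplexScalars => @complex.Im R
  end.

(** The value 0 over the reals lets the single formula [unit_coord] cover both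
    kinds of scalars. *)
Definition imag_unit : K :=
  match s with
  | RealScalars => (0 : R)
  | ComplexScalars => ('i%C : R[i])
  end.

Definition real_coord (g : bool) (z : K) : R := if g then imag_of z else real_of z.

Definition scalar_unit (g : bool) : K := if g then imag_unit else 1.

Lemma real_coordD g (z w : K) : real_coord g (z + w) = real_coord g z + real_coord g w.
Proof.
by rewrite /real_coord /imag_of /real_of; case: s z w => /=; case: g => //= z w;
  rewrite ?addr0 ?raddfD.
Qed.

Lemma real_coordZ g (a : R) (z : K) : real_coord g (of_real a * z) = a * real_coord g z.
Proof.
rewrite /real_coord /imag_of /real_of /of_real; case: s z => /=; case: g => //=.
- by rewrite mulr0.
- by move=> [x y] /=; rewrite mul0r addr0.
- by move=> [x y] /=; rewrite mul0r subr0.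
Qed.

Lemma real_coord_sum g (J : Type) (r : seq J) (F : J -> K) :
  real_coord g (\sum_(j <- r) F j) = \sum_(j <- r) real_coord g (F j).
Proof.
have c0 : real_coord g 0 = 0.
  by rewrite -(mul0r (1 : K)) -(of_real0 (s := s)) real_coordZ mul0r.
by rewrite (big_morph (real_coord g) (real_coordD g) c0).
Qed.

Lemma unit_coord (z : K) : z = \sum_(g : bool) of_real (real_coord g z) * scalar_unit g.
Proof.
rewrite big_bool /= /real_coord /scalar_unit /imag_of /imag_unit /real_of /of_real.
case: s z => /= [z|[x y]]; first by rewrite mulr0 add0r mulr1.
by apply/eqP; rewrite eq_complex /=; apply/andP; split; apply/eqP; simpc; ring.
Qed.

Lemma rnormM (a b : K) : rnorm (a * b : K^o) = rnorm (a : K^o) * rnorm (b : K^o).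
Proof. by rewrite -(rnormZ (a : K^o) (b : K^o)). Qed.

Lemma rnorm_of_real (a : R) : rnorm (of_real a : K^o) = `|a|.
Proof.
rewrite /rnorm /real_of /of_real; case: s => //=.
by rewrite /Num.norm/= expr0n addr0 sqrtr_sqr.
Qed.

Lemma rnorm_unit g : rnorm (scalar_unit g : K^o) <= 1.
Proof.
case: g; rewrite /scalar_unit ?/imag_unit /rnorm /real_of; case: s => /=; rewrite ?normr0 ?normr1 ?ler01//=.
  by rewrite expr0n/= add0r expr1n sqrtr1.
by rewrite expr1n expr0n/= addr0 sqrtr1.
Qed.

Lemma coord_le_rnorm g (z : K) : `|real_coord g z| <= rnorm (z : K^o).
Proof.
rewrite /real_coord /imag_of /real_of /rnorm; case: s z => /= z; case: g => //=.
- by rewrite normr0.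
- by case: z => x y /=; rewrite -sqrtr_sqr ler_wsqrtr// lerDr sqr_ge0.
- by case: z => x y /=; rewrite -sqrtr_sqr ler_wsqrtr// lerDl sqr_ge0.
Qed.

Lemma rnorm_le_coord (z : K) : rnorm (z : K^o) <= \sum_(g : bool) `|real_coord g z|.
Proof.
rewrite {1}(unit_coord z) big_bool big_bool /=.
apply: (le_trans (rnormD _ _)); apply: lerD; rewrite rnormM rnorm_of_real.
  by rewrite ler_piMr// (rnorm_unit true).
by rewrite ler_piMr// (rnorm_unit false).
Qed.

Lemma rnorm_sum (V : normedModType K) (J : Type) (r : seq J) (P : pred J) (F : J -> V) :
  rnorm (\sum_(j <- r | P j) F j) <= \sum_(j <- r | P j) rnorm (F j).
Proof.
elim/big_rec2: _ => [|j y1 y2 _ IH]; first by rewrite rnorm0.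
by apply: (le_trans (rnormD _ _)); rewrite lerD2l.
Qed.

Lemma rnormN (V : normedModType K) (x : V) : rnorm (- x) = rnorm x.
Proof. by rewrite /rnorm normrN. Qed.

End ScalarCoordinates.

(** * Partial sums in sequence spaces *)

Section EllSums.
Context {R : realType} {s : scalar_kind}.
Local Notation K := (scalars R s).

Lemma ell_norm_le (q B : R) (y : nat -> K^o) : 0 < q -> 0 <= B ->
  (forall L, \sum_(c < L) rnorm (y c) `^ q <= B `^ q) -> (ell_norm q%:E y <= B%:E)%E.
Proof.
move=> q0 B0 yB; rewrite ell_norm_fin_expE//.
have S0 : (0 <= \sum_(0 <= j <oo) (rnorm (y j) `^ q)%:E)%E.
  by apply: nneseries_ge0 => j _ _; rewrite lee_fin powR_ge0.
have SB : (\sum_(0 <= j <oo) (rnorm (y j) `^ q)%:E <= (B `^ q)%:E)%E.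
  apply: lime_le; first by apply: is_cvg_nneseries => j _ _; rewrite lee_fin powR_ge0.
  by apply: nearW => L; rewrite sumEFin lee_fin big_mkord.
rewrite (_ : B%:E = ((B `^ q)%:E `^ q^-1)%E); last first.
  by rewrite poweR_EFin -powRrM mulfV ?gt_eqF// powRr1.
apply: gt0_ler_poweR => //; first by rewrite invr_ge0 ltW.
- by rewrite in_itv/= S0 leey.
- by rewrite in_itv/= leey andbT lee_fin powR_ge0.
Qed.

Lemma ell_norm_pinfty_le (B : R) (y : nat -> K^o) :
  (forall c, rnorm (y c) <= B) -> (ell_norm +oo%E y <= B%:E)%E.
Proof.
move=> yB; rewrite ell_norm_pinftyE; apply: ge_ereal_sup => _ [c _ <-].
by rewrite lee_fin.
Qed.

Lemma ell_series (q : R) (q1 : (1 <= q%:E)%E) (x : ell s q1) :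
  (\sum_(0 <= j <oo) (rnorm (x j) `^ q)%:E = (rnorm x `^ q)%:E)%E.
Proof.
have q0 : 0 < q by have := q1; rewrite lee_fin; exact: lt_le_trans.
have S0 : (0 <= \sum_(0 <= j <oo) (rnorm (x j) `^ q)%:E)%E.
  by apply: nneseries_ge0 => j _ _; rewrite lee_fin powR_ge0.
rewrite -poweR_EFin ell_rnormE ell_norm_fin_expE// -poweRrM mulVf ?gt_eqF//.
by rewrite poweRe1.
Qed.

Lemma ell_partial_sum (q : R) (q1 : (1 <= q%:E)%E) (x : ell s q1) L :
  \sum_(c < L) rnorm (x c) `^ q <= rnorm x `^ q.
Proof.
rewrite -lee_fin -ell_series -sumEFin -(big_mkord xpredT (fun c => (rnorm (x c) `^ q)%:E)).
by apply: nneseries_lim_ge => j _ _; rewrite lee_fin powR_ge0.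
Qed.

Lemma ell_partial_sum_near (q : R) (q1 : (1 <= q%:E)%E) (x : ell s q1) (a : R) :
  a < rnorm x `^ q -> exists L0, forall L, (L0 <= L)%N ->
  a <= \sum_(c < L) rnorm (x c) `^ q.
Proof.
rewrite -lte_fin -ell_series => /lte_lim [].
- by apply/ereal_nondecreasing_series => j _ _; rewrite lee_fin powR_ge0.
- by apply: is_cvg_nneseries => j _ _; rewrite lee_fin powR_ge0.
move=> L0 _ H; exists L0 => L /H /=.
by rewrite sumEFin lee_fin big_mkord.
Qed.

Lemma ell_coord_le (p : \bar R) (p1 : (1 <= p)%E) (x : ell s p1) c : rnorm (x c) <= rnorm x.
Proof.
case: p p1 x => [q| |] p1 x //; last first.
  rewrite -lee_fin ell_rnormE ell_norm_pinftyE.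
  by apply: ereal_sup_ubound; exists c.
have q0 : 0 < q by have := p1; rewrite lee_fin; exact: lt_le_trans.
have := ell_partial_sum x c.+1; rewrite big_ord_recr/=.
have : 0 <= \sum_(i < c) rnorm (x i) `^ q by apply: sumr_ge0 => i _; exact: powR_ge0.
move=> S0 H; have {S0}H : rnorm (x c) `^ q <= rnorm x `^ q by lra.
rewrite leNgt; apply/negP => lt.
by move: H; apply/negP; rewrite -ltNge gt0_ltr_powR// nnegrE rnorm_ge0.
Qed.

End EllSums.

(** * Weak summability and multilinear maps *)

Section Multilinear.
Context {R : realType} {s : scalar_kind}.
Local Notation K := (scalars R s).

Lemma weakly_summable_bound (E : normedModType K) (x : nat -> E) :
  weakly_summable x -> exists W : R, 0 <= W /\
  forall (phi : {linear E -> K^o}) N, @dual_unit_ball R s E phi ->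
    \sum_(j < N) rnorm (phi (x j)) <= W.
Proof.
rewrite /weakly_summable/=; set S := ereal_sup _ => Soo.
have Sle (phi : {linear E -> K^o}) N : @dual_unit_ball R s E phi ->
    ((\sum_(j < N) rnorm (phi (x j)))%:E <= S)%E.
  move=> phi1; apply: (@le_trans _ _ (\sum_(0 <= j <oo) (rnorm (phi (x j)))%:E)%E).
    rewrite -sumEFin -(big_mkord xpredT (fun j => (rnorm (phi (x j)))%:E)).
    by apply: nneseries_lim_ge => j _ _; rewrite lee_fin rnorm_ge0.
  by apply: ereal_sup_ubound; exists phi.
have S0 : (0 <= S)%E.
  have := Sle \0 0%N; rewrite big_ord0; apply => z _.
  by rewrite /= rnorm0.
have Sfin : S \is a fin_num by rewrite ge0_fin_numE.
exists (fine S); split; first exact: fine_ge0.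
by move=> phi N /(Sle phi N); rewrite -{1}(fineK Sfin) lee_fin.
Qed.

Variables (m : nat) (E F : normedModType K) (T : ('I_m -> E) -> F).
Hypothesis Tlin : multilinear T.

Lemma multilinear0 x i : T (dfwith x i 0) = 0.
Proof.
have := Tlin x i (-1) 0 0; rewrite scaler0 addr0 scaleN1r => h.
by rewrite h addNr.
Qed.

Lemma multilinear_sum (J : Type) (r : seq J) (a : J -> K) (v : J -> E) x i :
  T (dfwith x i (\sum_(j <- r) a j *: v j)) =
  \sum_(j <- r) a j *: T (dfwith x i (v j)).
Proof.
elim: r => [|j r IH]; first by rewrite !big_nil multilinear0.
by rewrite !big_cons Tlin IH.
Qed.

Lemma multilinearB x i u v :
  T (dfwith x i (u - v)) = T (dfwith x i u) - T (dfwith x i v).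
Proof. by rewrite -[u - v]addrC -scaleN1r Tlin scaleN1r addrC. Qed.

Variable C : R.
Hypothesis C0 : 0 <= C.
Hypothesis TC : forall x, rnorm (T x) <= C * \prod_(i < m) rnorm (x i).

(** Replace the arguments one at a time and sum the differences. *)
Lemma multilinear_near (x : 'I_m -> E) (eta : R) : 0 < eta ->
  exists2 dl : R, 0 < dl & forall y : 'I_m -> E,
    (forall i, rnorm (x i - y i) <= dl) -> rnorm (T x - T y) <= eta.
Proof.
move=> eta0; pose b := 1 + \sum_i rnorm (x i).
have xs0 : 0 <= \sum_i rnorm (x i) by apply: sumr_ge0 => i _; exact: rnorm_ge0.
have b1 : 1 <= b by rewrite /b lerDl.
have xb i : rnorm (x i) + 1 <= b.
  by rewrite /b addrC lerD2l (bigD1 i)//= lerDl sumr_ge0// => j _; exact: rnorm_ge0.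
pose c := m%:R * (C * b ^+ m) + 1.
have c0 : 0 < c.
  by rewrite ltr_pwDr// mulr_ge0// mulr_ge0// exprn_ge0// (le_trans _ b1).
exists (Num.min 1 (eta / c)) => [|y xy]; first by rewrite lt_min ltr01 divr_gt0.
set dl := Num.min 1 (eta / c) in xy.
have dl0 : 0 < dl by rewrite lt_min ltr01 divr_gt0.
have dl1 : dl <= 1 by rewrite ge_min lexx.
have dlc : c * dl <= eta by rewrite mulrC -ler_pdivlMr// ge_min lexx orbT.
pose mix l (i : 'I_m) := if (i < l)%N then y i else x i.
have mixb l i : rnorm (mix l i) <= b.
  rewrite /mix; case: ifP => _; last by apply: le_trans (xb i); rewrite lerDl.
  rewrite -(subrK (x i) (y i)) -opprB (le_trans (rnormD _ _))// rnormN.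
  by apply: le_trans (xb i); rewrite addrC lerD2l (le_trans (xy i)).
have step l : (l < m)%N -> rnorm (T (mix l) - T (mix l.+1)) <= C * b ^+ m * dl.
  move=> lm; pose L := Ordinal lm.
  have -> : mix l = dfwith (mix l) L (x L).
    apply/funext => i; case: dfwithP => //.
    by rewrite /mix /= ltnn.
  have -> : mix l.+1 = dfwith (mix l) L (y L).
    apply/funext => i; case: dfwithP => [|j jL]; first by rewrite /mix /= ltnSn.
    rewrite /mix ltnS leq_eqVlt (_ : (j == l :> nat) = false) //.
    by apply: contraNF jL => /eqP jl; apply/eqP/val_inj.
  rewrite -multilinearB; apply: (le_trans (TC _)).
  rewrite -mulrA ler_wpM2l// (bigD1 L)//= dfwithin mulrC.
  apply: ler_pM; rewrite ?rnorm_ge0//.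
    by apply: prodr_ge0 => i _; exact: rnorm_ge0.
  apply: (@le_trans _ _ (\prod_(i < m | i != L) b)).
    by apply: ler_prod => i iL; rewrite rnorm_ge0 dfwithout 1?eq_sym// mixb.
  have -> : b ^+ m = \prod_(i < m) b by rewrite prodr_const card_ord.
  rewrite [leRHS](bigD1 L)//= ler_peMl// prodr_ge0// => i _; lra.
have tele l : (l <= m)%N -> rnorm (T x - T (mix l)) <= l%:R * (C * b ^+ m * dl).
  elim: l => [_|l IH lm].
    by rewrite (_ : mix 0%N = x) ?subrr ?rnorm0 ?mul0r//; apply/funext.
  rewrite -(subrKA (T (mix l))) (le_trans (rnormD _ _))// -natr1 mulrDl mul1r.
  by rewrite lerD// ?IH ?step// ltnW.
have := tele m (leqnn m).
rewrite (_ : mix m = y); last by apply/funext => i; rewrite /mix ltn_ord.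
move=> /le_trans; apply; apply: le_trans dlc; rewrite mulrA /c mulrDl mul1r lerDl.
exact: ltW.
Qed.

(** Continuity up to a factor 2, to which summability is insensitive. *)
Lemma multilinear_half (x : 'I_m -> E) (y : nat -> 'I_m -> E) :
  (forall i (dl : R), 0 < dl -> exists M0, forall M, (M0 <= M)%N -> rnorm (x i - y M i) <= dl) ->
  exists M0, forall M, (M0 <= M)%N -> rnorm (T x) <= 2 * rnorm (T (y M)).
Proof.
move=> yx; have [T0|T0] := eqVneq (rnorm (T x)) 0.
  by exists 0%N => M _; rewrite T0 mulr_ge0// rnorm_ge0.
have Tp : 0 < rnorm (T x) / 2 by rewrite divr_gt0// lt_def T0 rnorm_ge0.
have [dl dl0 H] := multilinear_near x Tp.
have [M0 HM] := choice (fun i => yx i dl dl0).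
exists (\max_i M0 i) => M MM.
have /H : forall i, rnorm (x i - y M i) <= dl.
  by move=> i; apply: HM; apply: leq_trans MM; exact: leq_bigmax.
have := rnormD (T x - T (y M)) (T (y M)); rewrite subrK; lra.
Qed.

End Multilinear.

(** * Truncation in l_1 *)

Section EllOne.
Context {R : realType} {s : scalar_kind}.
Local Notation K := (scalars R s).
Local Notation l1 := (ell s (lexx (1%E : \bar R))).

Lemma ell_coordP (p : \bar R) (p1 : (1 <= p)%E) (a : K) (x y : ell s p1) c :
  (a *: x + y) c = a * x c + y c :> K.
Proof. by []. Qed.

Lemma ell_coord_sum (p : \bar R) (p1 : (1 <= p)%E) (J : Type) (r : seq J)
    (a : J -> K) (x : J -> ell s p1) c :
  (\sum_(j <- r) a j *: x j) c = \sum_(j <- r) a j * x j c :> K.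
Proof.
elim: r => [|j r IH]; first by rewrite !big_nil.
by rewrite !big_cons ell_coordP IH.
Qed.

Lemma of_real1 : of_real 1 = 1 :> K.
Proof. by case: s. Qed.

Lemma rnorm_one : rnorm (1 : K^o) = 1.
Proof. by rewrite -[in LHS]of_real1 rnorm_of_real normr1. Qed.

Lemma ell_norm_unit_vector (a : nat) :
  (ell_norm 1%E (fun c => (c == a)%:R : K^o) <= 1%:E)%E.
Proof.
apply: ell_norm_le => // L; rewrite powR1.
under eq_bigr do rewrite powRr1 ?rnorm_ge0//.
have r1 c : rnorm ((c == a)%:R : K^o) = (c == a)%:R.
  by case: (c == a); rewrite ?rnorm0 ?rnorm_one.
under eq_bigr do rewrite r1.
have [aL|La] := ltnP a L.
  rewrite (bigD1 (Ordinal aL))//= eqxx big1 ?addr0// => i.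
  by rewrite -val_eqE/= => /negbTE ->.
rewrite big1// => i _; rewrite (_ : _ == _ = false)//.
by apply: ltn_eqF; exact: leq_trans La.
Qed.

Lemma unit_vector_in (a : nat) : (fun c => (c == a)%:R : K^o) \in in_ell (1%E : \bar R).
Proof.
by rewrite unfold_in; apply: (le_lt_trans (ell_norm_unit_vector a)); exact: ltry.
Qed.

Definition unit_vector (a : nat) : l1 := Ell (lexx 1%E) (unit_vector_in a).

Lemma rnorm_unit_vector (a : nat) : rnorm (unit_vector a) <= 1.
Proof. by rewrite -lee_fin ell_rnormE; exact: ell_norm_unit_vector. Qed.

End EllOne.

Section Truncation.
Context {R : realType} {s : scalar_kind}.
Local Notation K := (scalars R s).
Local Notation l1 := (ell s (lexx (1%E : \bar R))).

Lemma l1_rnorm_le (x : l1) (B : R) : 0 <= B ->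
  (forall L, \sum_(c < L) rnorm (x c) <= B) -> rnorm x <= B.
Proof.
move=> B0 xB; rewrite -lee_fin ell_rnormE; apply: ell_norm_le => // L.
by rewrite powRr1//; under eq_bigr do rewrite powRr1 ?rnorm_ge0//.
Qed.

Lemma l1_partial_sum (x : l1) L : \sum_(c < L) rnorm (x c) <= rnorm x.
Proof.
have := ell_partial_sum x L; rewrite powRr1 ?rnorm_ge0//.
by under eq_bigr do rewrite powRr1 ?rnorm_ge0//.
Qed.

Lemma unit_vectorE (a c : nat) : unit_vector (s := s) (R := R) a c = (c == a)%:R :> K.
Proof. by []. Qed.

Definition trunc (M : nat) (x : l1) : l1 := \sum_(a < M) (x a : K) *: unit_vector a.

Lemma truncE M (x : l1) c : trunc M x c = (if (c < M)%N then x c else 0) :> K.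
Proof.
rewrite /trunc ell_coord_sum; case: ltnP => cM.
  rewrite (bigD1 (Ordinal cM))//= eqxx mulr1 big1 ?addr0// => a.
  by rewrite -val_eqE/= eq_sym => /negbTE ->; rewrite mulr0.
rewrite big1// => a _; rewrite unit_vectorE (_ : _ == _ = false) ?mulr0//.
by apply: gtn_eqF; exact: leq_trans cM.
Qed.

Lemma trunc_near (x : l1) (dl : R) : 0 < dl ->
  exists M0, forall M, (M0 <= M)%N -> rnorm (x - trunc M x) <= dl.
Proof.
move=> dl0; have lt : rnorm x - dl < rnorm x `^ 1.
  by rewrite powRr1 ?rnorm_ge0// ltrBlDr ltrDl.
have [M0 HM] := ell_partial_sum_near lt.
exists M0 => M /HM.
under eq_bigr do rewrite powRr1 ?rnorm_ge0//.
move=> H; apply: l1_rnorm_le => [|L]; first exact: ltW.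
have xt c : (x - trunc M x) c = (if (c < M)%N then 0 else x c) :> K^o.
  transitivity (-1 * trunc M x c + x c : K).
    by rewrite -ell_coordP scaleN1r addrC.
  by rewrite truncE mulN1r; case: ifP => _; rewrite ?addNr// oppr0 add0r.
apply: (@le_trans _ _ (\sum_(c < L | (M <= c)%N) rnorm (x c))).
  rewrite [leRHS]big_mkcond; apply: ler_sum => c _; rewrite xt ltnNge.
  by case: (M <= c)%N; rewrite ?rnorm0.
have := l1_partial_sum x (maxn L M).
rewrite (bigID (fun c : 'I__ => (M <= c)%N))/=.
have -> : \sum_(i < maxn L M | ~~ (M <= i)%N) rnorm (x i) = \sum_(i < M) rnorm (x i).
  rewrite [RHS](big_ord_widen _ (fun i => rnorm (x i)) (leq_maxr L M)).
  by apply: eq_bigl => i; rewrite ltnNge.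
have : \sum_(c < L | (M <= c)%N) rnorm (x c) <=
    \sum_(i < maxn L M | (M <= i)%N) rnorm (x i).
  rewrite (big_ord_widen_cond _ (fun i => M <= i)%N (fun i => rnorm (x i)) (leq_maxl L M)).
  rewrite [leRHS](bigID (fun i : 'I__ => (i < L)%N))/= lerDl.
  by apply: sumr_ge0 => i _; exact: rnorm_ge0.
move: H; lra.
Qed.

Definition l1_functional (M : nat) (w : 'I_M -> K) (x : l1) : K^o :=
  \sum_(a < M) w a * (x a : K).

Lemma l1_functional_linear M (w : 'I_M -> K) : linear (l1_functional w).
Proof.
move=> a x y; rewrite /l1_functional scaler_sumr -big_split; apply: eq_bigr => i _.
by rewrite ell_coordP mulrDr mulrCA.
Qed.

HB.instance Definition _ M (w : 'I_M -> K) :=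
  GRing.isLinear.Build K l1 K^o _ (l1_functional w) (l1_functional_linear w).

Lemma l1_functional_ball M (w : 'I_M -> K) :
  (forall a, rnorm (w a : K^o) <= 1) -> @dual_unit_ball R s l1 (l1_functional w).
Proof.
move=> w1 x x1; rewrite /= /l1_functional.
apply: le_trans (rnorm_sum _ _ _) _; apply: le_trans x1.
apply: le_trans (l1_partial_sum x M); apply: ler_sum => a _.
by rewrite rnormM ler_piMl ?rnorm_ge0.
Qed.

Lemma coord_pairing (d0 d1 : R) (z : K) :
  real_coord false ((of_real d0 - of_real d1 * imag_unit) * z) =
  d0 * real_coord false z + d1 * real_coord true z.
Proof.
rewrite /real_coord /imag_of /imag_unit /of_real /real_of; case: s z => /= [z|[x y]].
  by rewrite !mulr0 subr0 addr0.
by rewrite /=; simpc; rewrite /=; ring.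
Qed.

Lemma sum_pair (A B : finType) (V : nmodType) (F : A * B -> V) :
  \sum_p F p = \sum_a \sum_b F (a, b).
Proof. by rewrite pair_bigA; apply: eq_bigr => -[]. Qed.

(** Matrix of the truncated sequence with respect to the vectors
    [real_basis_vector]. Rows and columns share an index type, for which the rows
    with second component [true] are filled with zeros. *)
Definition trunc_coord (x : nat -> l1) (M : nat) (u v : 'I_M * bool) : R :=
  if u.2 then 0 else real_coord v.2 (x u.1 v.1 : K).

(** The signs [eta] define a functional on l_1. Over the complex numbers a
    coordinate carries two signs, one for each of its parts, so the coefficients
    of the functional are halved to bring it into the unit ball. *)
Lemma trunc_coord_bound (x : nat -> l1) : weakly_summable x ->
  exists W : R, 0 <= W /\ forall M, bilinear_bound (@trunc_coord x M) W.
Proof.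
move=> /weakly_summable_bound[W [W0 xW]]; exists (2 * W); split=> [|M xi eta xi1 eta1].
  by rewrite mulr_ge0.
pose w (a : 'I_M) : K := of_real 2^-1 *
  (of_real (eta (a, false)) - of_real (eta (a, true)) * imag_unit).
have w1 a : rnorm (w a : K^o) <= 1.
  rewrite rnormM rnorm_of_real ger0_norm// ler_pdivrMl// mulr1.
  apply: (le_trans (rnormD _ _)); rewrite -[leRHS]/(1 + 1) lerD//.
    by rewrite rnorm_of_real.
  rewrite rnormN rnormM rnorm_of_real mulr_ile1 ?rnorm_ge0//.
  exact: (rnorm_unit true).
have := xW (l1_functional w) M (l1_functional_ball w1).
rewrite -(ler_pM2l (_ : 0 < 2))//; apply: le_trans.
rewrite sum_pair.
rewrite mulr_sumr; apply: ler_sum => j _; rewrite big_bool /=.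
rewrite {1}/trunc_coord/= big1 ?add0r => [|v _]; last by rewrite mul0r.
rewrite sum_pair.
have -> : \sum_(a < M) \sum_(g : bool) trunc_coord x (j, false) (a, g) * (xi (j, false) * eta (a, g)) =
    xi (j, false) * (2 * real_coord false (l1_functional w (x j) : K)).
  rewrite /l1_functional real_coord_sum !mulr_sumr; apply: eq_bigr => a _.
  by rewrite /w -mulrA real_coordZ coord_pairing big_bool /= /trunc_coord /=; field.
rewrite mulrCA ler_pM2l//; apply: le_trans (ler_norm _) _.
rewrite normrM; apply: le_trans (coord_le_rnorm false _).
by rewrite ler_piMl.
Qed.

Definition real_basis_vector (v : nat * bool) : l1 := (scalar_unit v.2 : K) *: unit_vector v.1.

Lemma rnorm_real_basis_vector v : rnorm (real_basis_vector v) <= 1.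
Proof.
rewrite /real_basis_vector rnormZ mulr_ile1 ?rnorm_ge0//; first exact: rnorm_unit.
exact: rnorm_unit_vector.
Qed.

Definition trunc_point (x : nat -> l1) (M : nat) (u : 'I_M * bool) : l1 :=
  if u.2 then 0 else trunc M (x u.1).

Lemma trunc_pointE (x : nat -> l1) M (u : 'I_M * bool) :
  trunc_point x u = \sum_(v : 'I_M * bool)
    (of_real (trunc_coord x u v) : K) *: real_basis_vector (val v.1, v.2).
Proof.
rewrite /trunc_point /trunc_coord; case: u.2.
  by rewrite big1// => v _; rewrite of_real0 scale0r.
rewrite sum_pair.
apply: eq_bigr => a _; rewrite {1}(unit_coord (x u.1 a : K)) scaler_suml.
by apply: eq_bigr => g _; rewrite /real_basis_vector scalerA.
Qed.

End Truncation.

(** * Summability of bounded multilinear operators *)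

Section UpperBound.
Context {R : realType} {s : scalar_kind}.
Local Notation K := (scalars R s).
Local Notation l1 := (ell s (lexx (1%E : \bar R))).

Lemma eventually_all (J : eqType) (r : seq J) (P : J -> nat -> Prop) :
  (forall j, exists M0, forall M, (M0 <= M)%N -> P j M) ->
  exists M0, forall M, (M0 <= M)%N -> forall j, j \in r -> P j M.
Proof.
move=> PJ; elim: r => [|j r [M1 H1]]; first by exists 0%N.
have [M2 H2] := PJ j; exists (maxn M1 M2) => M; rewrite geq_max => /andP[M1M M2M] i.
by rewrite inE => /predU1P[->|ir]; [exact: H2|exact: H1].
Qed.

(** A finite part of the sum involves finitely many vectors; one truncation serves
    all of them and, by [multilinear_half], costs a factor 2. *)
Lemma partially_summing_of_truncations (m : nat) (I : {set {set 'I_m}}) (t : R)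
    (F : normedModType K) (T : ('I_m -> l1) -> F) :
  0 < t -> bounded_multilinear m l1 F T ->
  (forall x : 'I_m -> nat -> l1, (forall i, weakly_summable (x i)) ->
    exists B : R, forall M,
      \sum_(b : {ffun 'I_m -> 'I_M * bool} | on_diagonals I b)
        rnorm (T (fun i => trunc_point (x i) (b i))) `^ t <= B) ->
  partially_summing I t l1 F T.
Proof.
move=> t0 Tb TI; split=> // x xw; have [B xB] := TI x xw.
have [Tlin [C0 TC0]] := Tb.
pose C := Num.max 0 C0.
have Cge0 : 0 <= C by rewrite le_max lexx.
have TC y : rnorm (T y) <= C * \prod_(i < m) rnorm (y i).
  apply: (le_trans (TC0 y)); rewrite ler_wpM2r ?le_max ?lexx ?orbT//.
  by apply: prodr_ge0 => i _; exact: rnorm_ge0.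
apply: (@le_lt_trans _ _ (2 `^ t * B)%:E); last exact: ltry.
apply: ge_ereal_sup => _ [A [Afin AI] <-].
rewrite fsbig_finite//=; set r := fset_set A.
pose P (j : {ffun 'I_m -> nat}) M := (forall i, (j i < M)%N) /\
  rnorm (T (fun i => x i (j i))) <= 2 * rnorm (T (fun i => trunc M (x i (j i)))).
have [|M0 HM0] := @eventually_all _ (enum_fset r) P.
  move=> j.
  have [M1 H1] := multilinear_half Tlin Cge0 TC
    (fun i dl dl0 => trunc_near (x i (j i)) dl0).
  exists (maxn M1 (\max_i (j i).+1)) => M; rewrite geq_max => /andP[M1M jM].
  split=> [i|]; last exact: H1.
  by apply: leq_trans jM; rewrite (leq_bigmax (F := fun i => (j i).+1)).
pose M := M0.+1.
have HM j : j \in r -> P j M by move=> jr; apply: HM0.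
rewrite sumEFin lee_fin.
apply: (@le_trans _ _ (2 `^ t * \sum_(b : {ffun 'I_m -> 'I_M * bool} | on_diagonals I b)
        rnorm (T (fun i => trunc_point (x i) (b i))) `^ t)); last first.
  by rewrite ler_wpM2l// powR_ge0.
pose h (j : {ffun 'I_m -> nat}) : {ffun 'I_m -> 'I_M * bool} :=
  [ffun i => (inord (j i), false)].
rewrite big_seq_fsetE/=.
pose G (b : {ffun 'I_m -> 'I_M * bool}) := rnorm (T (fun i => trunc_point (x i) (b i))) `^ t.
apply: (@le_trans _ _ (2 `^ t * \sum_(j : fset_sub_type r) G (h (fsval j)))).
  rewrite mulr_sumr; apply: ler_sum => j _.
  have jr : fsval j \in r by exact: fsvalP.
  have [jM jT] := HM _ jr.
  rewrite /G -powRM ?rnorm_ge0//.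
  rewrite (_ : (fun i => trunc_point (x i) (h (fsval j) i)) =
               (fun i => trunc M (x i (fsval j i)))); last first.
    by apply/funext => i; rewrite /trunc_point ffunE /= inordK.
  by apply: le_powR => //; rewrite ?rnorm_ge0// ltW.
rewrite ler_wpM2l ?powR_ge0//.
apply: (@ler_sum_inj R _ _ predT (fun b => on_diagonals I b) (fun j => h (fsval j)) G).
- move=> j j' _ _ hE; apply: val_inj; apply/ffunP => i.
  have [jM _] := HM _ (fsvalP j); have [jM' _] := HM _ (fsvalP j').
  have := congr1 (fun b : {ffun 'I_m -> 'I_M * bool} => val (b i).1) hE.
  by rewrite !ffunE /= !inordK.
- move=> j _; have jA : A (fsval j).
    by have := fsvalP j; rewrite in_fset_set// inE.
  apply/on_diagonalsP => L LI a c aL cL; rewrite !ffunE.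
  by rewrite (AI _ jA L LI a c aL cL).
- by move=> b; exact: powR_ge0.
Qed.

(** Expand the argument number [l] in the vectors [e]. *)
Lemma hybrid_step (m : nat) (U : finType) (E F : normedModType K) (T : ('I_m -> E) -> F)
    (y : 'I_m -> U -> E) (e : U -> E) (X : 'I_m -> U -> U -> R) :
  multilinear T ->
  (forall i b, y i b = \sum_u (of_real (X i b u) : K) *: e u) ->
  forall (l : 'I_m) (b : {ffun 'I_m -> U}),
    T (fun i => if (i < l.+1)%N then y i (b i) else e (b i)) =
    \sum_u (of_real (X l (b l) u) : K) *:
      T (fun i => if (i < l)%N then y i (upd b l u i) else e (upd b l u i)).
Proof.
move=> Tlin yX l b.
pose g (i : 'I_m) := if (i < l)%N then y i (b i) else e (b i).
have -> : (fun i : 'I_m => if (i < l.+1)%N then y i (b i) else e (b i)) =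
    dfwith g l (\sum_u (of_real (X l (b l) u) : K) *: e u).
  apply/funext => i; case: dfwithP => [|j lj]; first by rewrite ltnSn yX.
  rewrite /g ltnS leq_eqVlt (_ : (j == l :> nat) = false) //.
  by apply: contraNF lj => /eqP jl; apply/eqP/val_inj.
rewrite multilinear_sum//; apply: eq_bigr => u _; congr (_ *: T _).
apply/funext => i; case: dfwithP => [|j lj]; first by rewrite ltnn upd_same.
by rewrite /g upd_other// eq_sym.
Qed.

Lemma endpoint_summing (m : nat) (I : {set {set 'I_m}}) (F : normedModType K)
    (T : ('I_m -> l1) -> F) :
  (0 < m)%N -> finset.partition I [set: 'I_m]%SET ->
  bounded_multilinear m l1 F T ->
  partially_summing I (2 / (min_block_card I)%:R) l1 F T.
Proof.
move=> m0 Ipart Tb.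
have n0 : (0 < min_block_card I)%N by exact: min_block_card_gt0.
have t0 : 0 < 2 / (min_block_card I)%:R :> R by rewrite divr_gt0// ltr0n.
apply: partially_summing_of_truncations => // x xw.
have [Tlin [C0 TC0]] := Tb.
pose C := 1 + Num.max 0 C0.
have C1 : 0 < C by rewrite ltr_pwDl// le_max lexx.
have TC y : rnorm (T y) <= C * \prod_(i < m) rnorm (y i).
  apply: (le_trans (TC0 y)); rewrite ler_wpM2r//.
    by apply: prodr_ge0 => i _; exact: rnorm_ge0.
  by rewrite /C (@le_trans _ _ (Num.max 0 C0)) ?le_max ?lexx ?orbT// lerDr.
have [W HW] := choice (fun i => trunc_coord_bound (xw i)).
have W0 : 0 <= \sum_i W i by apply: sumr_ge0 => i _; have [] := HW i.
have [B HB] := endpoint_sum m0 Ipart W0.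
exists (C `^ (2 / (min_block_card I)%:R) * B) => M.
pose X i := @trunc_coord R s (x i) M.
have XW i : bilinear_bound (X i) (\sum_i W i).
  move=> xi eta xi1 eta1; apply: (le_trans ((HW i).2 M xi eta xi1 eta1)).
  by rewrite (bigD1 i)//= lerDl sumr_ge0// => k _; have [] := HW k.
pose N (b : {ffun 'I_m -> 'I_M * bool}) :=
  rnorm (T (fun i => trunc_point (x i) (b i))) / C.
have := HB _ X N XW _; rewrite -(ler_pM2l (powR_gt0 (2 / (min_block_card I)%:R) C1)).
move=> H; apply: le_trans (H _); last first.
  move=> b; rewrite divr_ge0 ?rnorm_ge0 ?(ltW C1)//= ler_pdivrMr// mulrC.
  apply: (le_trans (TC _)); rewrite ler_wpM2l ?(ltW C1)//.
  apply: ler_prod => i _; rewrite rnorm_ge0/= trunc_pointE.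
  apply: (le_trans (rnorm_sum _ _ _)); apply: ler_sum => v _.
  rewrite rnormZ rnorm_of_real ler_piMr//; exact: rnorm_real_basis_vector.
rewrite mulr_sumr; apply: ler_sum => b _.
by rewrite -powRM ?(ltW C1) ?divr_ge0 ?rnorm_ge0 ?(ltW C1)// /N [C * _]mulrC divfK// gt_eqF.
Qed.

Lemma rnorm_powR_le_coords (q : R) (z : K) : 0 < q ->
  rnorm (z : K^o) `^ q <= 2 `^ q * \sum_(g : bool) `|real_coord g z| `^ q.
Proof.
move=> q0; rewrite big_bool /=.
set a := `|real_coord true z|; set b := `|real_coord false z|.
have a0 : 0 <= a by exact: normr_ge0.
have b0 : 0 <= b by exact: normr_ge0.
pose M := Num.max a b; have M0 : 0 <= M by rewrite le_max a0.
have aM : a <= M by rewrite le_max lexx.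
have bM : b <= M by rewrite le_max lexx orbT.
apply: (@le_trans _ _ ((2 * M) `^ q)).
  apply: le_powR; rewrite ?(ltW q0) ?rnorm_ge0//.
  by apply: (le_trans (rnorm_le_coord z)); rewrite big_bool /= -/a -/b; lra.
rewrite powRM// ler_wpM2l ?powR_ge0// /M /Num.max.
by case: ifP => _; rewrite ?lerDl ?lerDr powR_ge0.
Qed.

(** The factor 4 is 2 for cutting the sequence at [L] times 2 for passing to real
    coordinates. *)
Lemma ell_rnorm_le_coords (q : R) (q1 : (1 <= q%:E)%E) (x : ell s q1) :
  exists L0, forall L, (L0 <= L)%N ->
  rnorm x <= 4 * (\sum_(v : 'I_L * bool) `|real_coord v.2 (x v.1 : K)| `^ q) `^ q^-1.
Proof.
have q0 : 0 < q by have := q1; rewrite lee_fin; exact: lt_le_trans.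
have [x0|xn] := eqVneq (rnorm x) 0.
  by exists 0%N => L _; rewrite x0 mulr_ge0// powR_ge0.
have xp : 0 < rnorm x by rewrite lt_def xn rnorm_ge0.
have lt : (rnorm x / 2) `^ q < rnorm x `^ q.
  by apply: gt0_ltr_powR; rewrite ?nnegrE ?rnorm_ge0//; lra.
have [L0 H] := ell_partial_sum_near lt; exists L0 => L /H {}H.
have S0 : 0 <= \sum_(v : 'I_L * bool) `|real_coord v.2 (x v.1 : K)| `^ q.
  by apply: sumr_ge0 => v _; exact: powR_ge0.
have : (rnorm x / 2) `^ q <=
    2 `^ q * \sum_(v : 'I_L * bool) `|real_coord v.2 (x v.1 : K)| `^ q.
  apply: (le_trans H); rewrite sum_pair mulr_sumr; apply: ler_sum => c _.
  exact: rnorm_powR_le_coords.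
move=> /(le_powR (ltW (_ : 0 < q^-1))); rewrite invr_gt0 => /(_ q0 (powR_ge0 _ _)).
rewrite [(2 `^ q * _) `^ _]powRM ?powR_ge0// -!powRrM mulfV ?gt_eqF// !powRr1 ?divr_ge0 ?rnorm_ge0//.
lra.
Qed.

Lemma interior_summing (m : nat) (I : {set {set 'I_m}}) (q q' t : R)
    (q1 : (1 <= q%:E)%E) (T : ('I_m -> l1) -> ell s q1) :
  (0 < m)%N -> finset.partition I [set: 'I_m]%SET -> 1 < q ->
  q' = (if q < 2 then q / (q - 1) else q) ->
  0 < t -> t * ((min_block_card I)%:R / 2 + q'^-1) = 1 ->
  bounded_multilinear m l1 (ell s q1) T ->
  partially_summing I t l1 (ell s q1) T.
Proof.
move=> m0 Ipart lt1q q'E t0 tq Tb.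
have q0 : 0 < q by exact: lt_trans lt1q.
apply: partially_summing_of_truncations => // x xw.
have [Tlin [C0 TC0]] := Tb.
pose C := 1 + Num.max 0 C0.
have C1 : 0 < C by rewrite ltr_pwDl// le_max lexx.
have TC y : rnorm (T y) <= C * \prod_(i < m) rnorm (y i).
  apply: (le_trans (TC0 y)); rewrite ler_wpM2r//.
    by apply: prodr_ge0 => i _; exact: rnorm_ge0.
  by rewrite /C (@le_trans _ _ (Num.max 0 C0)) ?le_max ?lexx ?orbT// lerDr.
have [W HW] := choice (fun i => trunc_coord_bound (xw i)).
have W0 : 0 <= \sum_i W i by apply: sumr_ge0 => i _; have [] := HW i.
have [B HB] := interior_sum m0 Ipart W0 lt1q q'E t0 tq.
exists ((4 * (2 * C)) `^ t * B) => M.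
pose U : finType := ('I_M * bool)%type.
pose X i := @trunc_coord R s (x i) M.
have XW i : bilinear_bound (X i) (\sum_i W i).
  move=> xi eta xi1 eta1; apply: (le_trans ((HW i).2 M xi eta xi1 eta1)).
  by rewrite (bigD1 i)//= lerDl sumr_ge0// => k _; have [] := HW k.
pose e (v : U) : l1 := real_basis_vector (val v.1, v.2).
have yX i (b : U) : trunc_point (x i) b = \sum_u (of_real (X i b u) : K) *: e u.
  exact: trunc_pointE.
pose zv l (b : {ffun 'I_m -> U}) : ell s q1 :=
  T (fun i => if (i < l)%N then trunc_point (x i) (b i) else e (b i)).
have zvS (l : 'I_m) b : zv l.+1 b = \sum_u (of_real (X l (b l) u) : K) *: zv l (upd b l u).
  exact: (hybrid_step Tlin yX).
have zvm b : zv m b = T (fun i => trunc_point (x i) (b i)).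
  by congr T; apply/funext => i; rewrite ltn_ord.
have [L HL] := @eventually_all _ (enum {ffun 'I_m -> U})
  (fun b L => rnorm (zv m b) <= 4 *
    (\sum_(v : 'I_L * bool) `|real_coord v.2 (zv m b v.1 : K)| `^ q) `^ q^-1)
  (fun b => ell_rnorm_le_coords (zv m b)).
have {}HL b := HL L (leqnn L) b (mem_enum _ b).
(* Dividing by [2 C], and not by [C], leaves room for the two real coordinates of
   each scalar, since [2 / 2^q <= 1]. *)
pose D := 2 * C; have D0 : 0 < D by rewrite mulr_gt0.
pose z l b (v : 'I_L * bool) : R := real_coord v.2 (zv l b v.1 : K) / D.
have zS (l : 'I_m) b v : z l.+1 b v = \sum_u X l (b l) u * z l (upd b l u) v.
  rewrite /z zvS ell_coord_sum real_coord_sum mulr_suml.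
  by apply: eq_bigr => u _; rewrite real_coordZ mulrA.
have zD l b v : `|z l b v| `^ q = D `^ (- q) * `|real_coord v.2 (zv l b v.1 : K)| `^ q.
  rewrite normrM normfV (gtr0_norm D0) powRM ?invr_ge0 ?(ltW D0)// mulrC; congr (_ * _).
  by rewrite -powR_inv1 ?(ltW D0)// -powRrM mulN1r.
have z0 a : \sum_v `|z 0%N a v| `^ q <= 1.
  under eq_bigr do rewrite zD.
  rewrite -mulr_sumr powRN mulrC ler_pdivrMr ?powR_gt0// mul1r.
  have zn : rnorm (zv 0%N a) <= C.
    apply: (le_trans (TC _)); rewrite ler_piMr ?(ltW C1)// prodr_ile1// => i.
    by rewrite rnorm_ge0/= rnorm_real_basis_vector.
  apply: (@le_trans _ _ (2 * \sum_(c < L) rnorm (zv 0%N a c) `^ q)).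
    rewrite sum_pair mulr_sumr; apply: ler_sum => c _; rewrite big_bool /=.
    have cl g : `|real_coord g (zv 0%N a c : K)| `^ q <= rnorm (zv 0%N a c) `^ q.
      by apply: le_powR; [exact: ltW|exact: normr_ge0|exact: coord_le_rnorm].
    by have := cl true; have := cl false; lra.
  apply: (@le_trans _ _ (2 * C `^ q)).
    rewrite ler_pM2l//; apply: (le_trans (ell_partial_sum _ _)).
    by apply: le_powR; rewrite ?(ltW q0) ?rnorm_ge0.
  rewrite /D powRM ?(ltW C1)// ler_wpM2r ?powR_ge0//.
  by apply: le1r_powR; [rewrite ler1n|exact: ltW].
have := HB _ _ X z XW zS z0.
rewrite -(ler_pM2l (powR_gt0 t (_ : 0 < 4 * D))) ?mulr_gt0//.
apply: le_trans; rewrite mulr_sumr; apply: ler_sum => b _.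
have D40 : 0 <= 4 * D by rewrite mulr_ge0// ltW.
rewrite -powRM ?powR_ge0//.
apply: le_powR; [exact: ltW|exact: rnorm_ge0|].
rewrite -zvm; apply: (le_trans (HL b)).
rewrite -mulrA ler_pM2l//.
under [in leRHS]eq_bigr do rewrite zD.
rewrite -mulr_sumr powRM ?powR_ge0//; last by apply: sumr_ge0 => v _; exact: powR_ge0.
by rewrite -powRrM mulNr mulfV ?gt_eqF// powR_inv1 ?(ltW D0)// mulVKf// gt_eqF.
Qed.

End UpperBound.

(** * Walsh matrices on dyadic blocks *)

Section DyadicBlocks.
Context {R : realType}.

(** The exponent [k] such that [c] lies in the dyadic block [2^k, 2^(k+1)); the
    index 0 belongs to no block and is treated apart. *)
Definition block_of (c : nat) : nat := trunc_log 2 c.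

Lemma block_ofE k c : (2 ^ k <= c < 2 ^ k.+1)%N -> block_of c = k.
Proof. by move=> h; exact: trunc_log_eq. Qed.

Lemma block_ofP c : (0 < c)%N -> (2 ^ block_of c <= c < 2 ^ (block_of c).+1)%N.
Proof. by move=> c0; exact: trunc_log_bounds. Qed.

Lemma sum_double (V : nmodType) (F : nat -> V) (a b : nat) : (a <= b)%N ->
  \sum_(a.*2 <= c < b.*2) F c = \sum_(a <= d < b) (F d.*2 + F d.*2.+1).
Proof.
move=> /subnKC <-; elim: (b - a)%N => [|n IH]; first by rewrite addn0 !big_geq.
rewrite addnS doubleS [RHS]big_nat_recr ?leq_addr//= -IH.
rewrite big_nat_recr/=; last by rewrite ltnW// ltnS leq_double leq_addr.
by rewrite big_nat_recr/= ?leq_double ?leq_addr// addrA.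
Qed.

Lemma sum_blocks (V : nmodType) (F : nat -> V) (n : nat) :
  \sum_(1 <= c < 2 ^ n) F c = \sum_(k < n) \sum_(2 ^ k <= c < 2 ^ k.+1) F c.
Proof.
elim: n => [|n IH]; first by rewrite big_ord0 big_geq.
by rewrite big_ord_recr/= -IH -big_cat_nat ?expn_gt0// leq_exp2l.
Qed.

(** Entries of the Hadamard matrix of Sylvester: the sign of the inner product of
    the last [k] binary digits. Ignoring the leading digit lets a dyadic block
    index the rows and the columns. *)
Fixpoint walsh (k c a : nat) : R :=
  if k is k'.+1 then (-1) ^+ (odd c && odd a) * walsh k' c./2 a./2 else 1.

Lemma walshC k c a : walsh k c a = walsh k a c.
Proof. by elim: k c a => //= k IH c a; rewrite andbC IH. Qed.

Lemma normr_walsh k c a : `|walsh k c a| = 1.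
Proof.
elim: k c a => [|k IH] c a /=; first by rewrite normr1.
by rewrite normrM IH normrX normrN1 expr1n mulr1.
Qed.

(** Split the columns according to the last digit: the two halves cancel when the
    last digits of [c] and [d] differ, and otherwise agree with the matrix of the
    previous order. *)
Lemma walsh_orthogonal k c d :
  (2 ^ k <= c < 2 ^ k.+1)%N -> (2 ^ k <= d < 2 ^ k.+1)%N ->
  \sum_(2 ^ k <= a < 2 ^ k.+1) walsh k c a * walsh k d a =
    if c == d then 2 ^+ k else 0.
Proof.
elim: k c d => [|k IH] c d.
  rewrite expn0 expn1 => /andP[c1 c2] /andP[d1 d2].
  have -> : c = 1%N by apply/eqP; rewrite eqn_leq c1 -ltnS c2.
  have -> : d = 1%N by apply/eqP; rewrite eqn_leq d1 -ltnS d2.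
  by rewrite big_nat1 /= mulr1.
rewrite !expnS !mul2n => /andP[c1 c2] /andP[d1 d2].
rewrite sum_double; last by rewrite -mul2n -expnS leq_exp2l.
have half e : ((2 ^ k).*2 <= e)%N -> (e < (2 ^ k).*2.*2)%N -> (2 ^ k <= e./2 < 2 ^ k.+1)%N.
  by rewrite expnS; lia.
pose sg (b : bool) : R := (-1) ^+ b.
rewrite (eq_bigr (fun a => (1 + sg (odd c) * sg (odd d)) * (walsh k c./2 a * walsh k d./2 a))); last first.
  move=> a _ /=; rewrite odd_double /= doubleK uphalf_double !andbF !andbT /sg; ring.
rewrite -mulr_sumr -mul2n -expnS IH ?half//.
have [->|cd] := eqVneq c d; first by rewrite eqxx /sg -signr_addb addbb expr0 exprS.
have [h|h] := eqVneq c./2 d./2; last by rewrite mulr0.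
have -> : sg (odd c) * sg (odd d) = -1.
  have : odd c != odd d.
    by apply: contra cd => /eqP od; rewrite -(odd_double_half c) -(odd_double_half d) od h.
  by rewrite /sg; case: (odd c); case: (odd d) => //= _; rewrite ?expr0 ?expr1 ?mulr1 ?mul1r.
by rewrite subrr mul0r.
Qed.

(** Parseval's identity for the Walsh matrix and the Cauchy-Schwarz inequality. *)
Lemma walsh_l1_bound k (y : nat -> R) : (forall a, `|y a| <= 1) ->
  \sum_(2 ^ k <= c < 2 ^ k.+1) `|\sum_(2 ^ k <= a < 2 ^ k.+1) walsh k c a * y a| <=
    Num.sqrt 2 ^+ (3 * k).
Proof.
move=> y1; set b : R := Num.sqrt 2.
have b0 : 0 < b by rewrite sqrtr_gt0.
have bb : b ^+ 2 = 2 by rewrite sqr_sqrtr.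
have bk0 : 0 < b ^+ k by rewrite exprn_gt0.
have NE : 2 ^+ k = (b ^+ k) ^+ 2 :> R by rewrite -exprM mulnC exprM bb.
have card : (2 ^ k.+1 - 2 ^ k = 2 ^ k)%N by rewrite expnS mul2n -addnn addnK.
have sumN (c : R) : \sum_(2 ^ k <= a < 2 ^ k.+1) c = 2 ^+ k * c.
  by rewrite sumr_const_nat card -[LHS]mulr_natl natrX.
pose v c := \sum_(2 ^ k <= a < 2 ^ k.+1) walsh k c a * y a.
have Sv : \sum_(2 ^ k <= c < 2 ^ k.+1) v c ^+ 2 <= (2 ^+ k) ^+ 2.
  have -> : \sum_(2 ^ k <= c < 2 ^ k.+1) v c ^+ 2 =
      \sum_(2 ^ k <= a < 2 ^ k.+1) 2 ^+ k * y a ^+ 2.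
    under eq_bigr do rewrite expr2 /v mulr_suml.
    rewrite exchange_big/= big_nat [RHS]big_nat; apply: eq_bigr => a aI.
    under eq_bigr do rewrite mulr_sumr.
    rewrite exchange_big/= big_nat.
    rewrite (eq_bigr (fun a' => (if a == a' then 2 ^+ k else 0) * (y a * y a'))).
      rewrite -big_nat (bigD1_seq a) ?iota_uniq ?mem_index_iota//= eqxx big1 ?addr0 ?expr2//.
      by move=> a'; rewrite eq_sym => /negbTE ->; rewrite mul0r.
    move=> a' a'I; rewrite -walsh_orthogonal// mulr_suml; apply: eq_bigr => c _.
    by rewrite (walshC k a c) (walshC k a' c); ring.
  rewrite -mulr_sumr expr2 ler_pM2l ?exprn_gt0//.
  apply: (@le_trans _ _ (\sum_(2 ^ k <= a < 2 ^ k.+1) 1)); last by rewrite sumN mulr1.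
  by apply: ler_sum => a _; rewrite -(real_normK (num_real _)) exprn_ile1.
apply: (@le_trans _ _ (\sum_(2 ^ k <= c < 2 ^ k.+1) (v c ^+ 2 / b ^+ k + b ^+ k) / 2)).
  apply: ler_sum => c _; rewrite -/(v c).
  rewrite (_ : (v c ^+ 2 / b ^+ k + b ^+ k) / 2 =
    `|v c| + (`|v c| - b ^+ k) ^+ 2 / (2 * b ^+ k)); last first.
    by rewrite -(real_normK (num_real (v c))); field; rewrite gt_eqF.
  by rewrite lerDl divr_ge0 ?sqr_ge0// mulr_ge0// ltW.
rewrite -mulr_suml big_split/= -mulr_suml sumN.
rewrite ler_pdivrMr//.
have H : (\sum_(2 ^ k <= c < 2 ^ k.+1) v c ^+ 2) / b ^+ k <= (2 ^+ k) ^+ 2 / b ^+ k.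
  by rewrite ler_wpM2r// invr_ge0 ltW.
apply: (le_trans (lerD H (lexx _))).
rewrite mulnC exprM NE le_eqVlt; apply/orP; left; apply/eqP.
by field; rewrite gt_eqF.
Qed.

End DyadicBlocks.

(** * The Walsh operator *)

Section WalshOperator.
Context {R : realType} {s : scalar_kind}.
Local Notation K := (scalars R s).
Local Notation l1 := (ell s (lexx (1%E : \bar R))).

Definition walsh_row (c : nat) (x : l1) : K :=
  \sum_(2 ^ block_of c <= a < 2 ^ (block_of c).+1)
    of_real (walsh (block_of c) c a) * (x a : K).

Definition block_norm (k : nat) (x : l1) : R :=
  \sum_(2 ^ k <= a < 2 ^ k.+1) rnorm (x a).

Lemma walsh_row_linear c (a : K) (x y : l1) :
  walsh_row c (a *: x + y) = a * walsh_row c x + walsh_row c y.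
Proof.
rewrite /walsh_row mulr_sumr -big_split; apply: eq_bigr => i _.
by rewrite ell_coordP mulrDr mulrCA.
Qed.

Lemma walsh_row_le c (x : l1) : rnorm (walsh_row c x : K^o) <= block_norm (block_of c) x.
Proof.
apply: (le_trans (rnorm_sum _ _ _)); apply: ler_sum => a _.
by rewrite rnormM rnorm_of_real normr_walsh mul1r.
Qed.

Lemma block_norm_ge0 k x : 0 <= block_norm k x.
Proof. by apply: sumr_ge0 => a _; exact: rnorm_ge0. Qed.

Lemma sum_block_norm_le n (x : l1) : \sum_(k < n) block_norm k x <= rnorm x.
Proof.
rewrite /block_norm -(sum_blocks (fun a => rnorm (x a))).
apply: le_trans (l1_partial_sum x (2 ^ n)).
rewrite -(big_mkord xpredT (fun a => rnorm (x a))).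
by rewrite [leRHS](big_cat_nat (n := 1))//= ?expn_gt0// lerDr sumr_ge0// => i _; exact: rnorm_ge0.
Qed.

Lemma block_norm_le k (x : l1) : block_norm k x <= rnorm x.
Proof.
apply: le_trans (sum_block_norm_le k.+1 x); rewrite big_ord_recr/= lerDr.
by apply: sumr_ge0 => i _; exact: block_norm_ge0.
Qed.

(** This is 2^(- 1 / p), with the convention 1 / oo = 0. *)
Definition dyadic_weight (p : \bar R) : R :=
  if p is q%:E then 2 `^ (- q^-1) else 1.

Lemma dyadic_weight_gt0 p : 0 < dyadic_weight p.
Proof. by case: p => [q| |] //=; rewrite ?ltr01// powR_gt0. Qed.

(** The weight 2^(- k / p) compensates in l_p for the 2^k elements of the block,
    and the l_p norm of the block bounds is at most their l_1 norm. *)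
Lemma dyadic_ell_bound (p : \bar R) (p1 : (1 <= p)%E) (v : nat -> K^o) (b : nat -> R) (B : R) :
  0 <= B -> (forall k, 0 <= b k) -> (forall n, \sum_(k < n) b k <= B) -> v 0%N = 0 ->
  (forall c, (0 < c)%N -> rnorm (v c) <= dyadic_weight p ^+ block_of c * b (block_of c)) ->
  (ell_norm p v <= B%:E)%E.
Proof.
move=> B0 b0 bB v0 vb; have bB1 k : b k <= B.
  by apply: le_trans (bB k.+1); rewrite big_ord_recr/= lerDr sumr_ge0.
case: p p1 vb => [q| |] // p1 vb; last first.
  apply: ell_norm_pinfty_le => -[|c]; first by rewrite v0 rnorm0.
  by apply: (le_trans (vb c.+1 _)) => //; rewrite /= expr1n mul1r.
have q1 : 1 <= q by have := p1; rewrite lee_fin.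
have q0 : 0 < q by exact: lt_le_trans q1.
apply: ell_norm_le => // L.
have vp c : 0 <= rnorm (v c) `^ q by exact: powR_ge0.
apply: (@le_trans _ _ (\sum_(1 <= c < 2 ^ L) rnorm (v c) `^ q)).
  rewrite -(big_mkord xpredT (fun c => rnorm (v c) `^ q)).
  case: L => [|L]; first by rewrite !big_geq.
  rewrite big_ltn// v0 rnorm0 powR0 ?gt_eqF// add0r.
  rewrite [leRHS](big_cat_nat (n := L.+1))//=; last by rewrite ltnW// ltn_expl.
  by rewrite lerDl sumr_ge0.
rewrite sum_blocks.
apply: (@le_trans _ _ (\sum_(k < L) b k `^ q)); last first.
  apply: (le_trans (sum_powR_le q1 _)) => [k|]; first exact: b0.
  by apply: le_powR; rewrite ?(ltW q0)// sumr_ge0.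
apply: ler_sum => k _.
apply: (@le_trans _ _ (\sum_(2 ^ k <= c < 2 ^ k.+1) 2 ^- k * b k `^ q)).
  rewrite big_nat [leRHS]big_nat; apply: ler_sum => c ck.
  have c0 : (0 < c)%N by case/andP: ck => h _; exact: leq_trans (expn_gt0 2 k) h.
  have := vb c c0; rewrite (block_ofE ck) => h.
  apply: (le_trans (le_powR (ltW q0) (rnorm_ge0 _) h)).
  rewrite powRM ?exprn_ge0 ?powR_ge0// ler_wpM2r ?powR_ge0//=.
  rewrite -powR_mulrn ?powR_ge0// -!powRrM mulrCA mulNr mulVf ?gt_eqF// mulrN1.
  by rewrite powRN powR_mulrn.
by rewrite sumr_const_nat expnS mul2n -addnn addnK -[leLHS]mulr_natl natrX mulrA
  mulfV ?mul1r ?expf_neq0.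
Qed.

Variables (m : nat) (B : {set 'I_m}) (i0 : 'I_m) (i0B : i0 \in B).
Variables (p : \bar R) (p1 : (1 <= p)%E).

(** The variables outside [B] enter only through their first coordinate. *)
Definition walsh_factor (c : nat) (i : 'I_m) (x : l1) : K :=
  if i \in B then walsh_row c x else (x 0%N : K).

Definition walsh_value (x : 'I_m -> l1) (c : nat) : K^o :=
  if c == 0%N then 0 else
  of_real (dyadic_weight p ^+ block_of c) * \prod_i walsh_factor c i (x i).

Lemma walsh_factor_le c i x : rnorm (walsh_factor c i x : K^o) <= rnorm x.
Proof.
rewrite /walsh_factor; case: ifP => _; last exact: ell_coord_le.
by apply: (le_trans (walsh_row_le _ _)); exact: block_norm_le.
Qed.

Lemma rnorm_prod (J : Type) (r : seq J) (P : pred J) (F : J -> K) :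
  rnorm (\prod_(j <- r | P j) F j : K^o) = \prod_(j <- r | P j) rnorm (F j : K^o).
Proof.
elim/big_rec2: _ => [|j y1 y2 _ IH]; first exact: rnorm_one.
by rewrite rnormM IH.
Qed.

Lemma walsh_value_bound x : (ell_norm p (walsh_value x) <= (\prod_i rnorm (x i))%:E)%E.
Proof.
pose P := \prod_(i < m | i != i0) rnorm (x i).
have P0 : 0 <= P by apply: prodr_ge0 => i _; exact: rnorm_ge0.
apply: (@dyadic_ell_bound p p1 _ (fun k => block_norm k (x i0) * P)) => //.
- by apply: prodr_ge0 => i _; exact: rnorm_ge0.
- by move=> k; rewrite mulr_ge0// block_norm_ge0.
- move=> n; rewrite -mulr_suml [leRHS](bigD1 i0)//= ler_wpM2r//.
  exact: sum_block_norm_le.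
move=> c c0; rewrite /walsh_value gtn_eqF// rnormM rnorm_of_real.
rewrite ger0_norm ?exprn_ge0 ?(ltW (dyadic_weight_gt0 _))//.
rewrite ler_wpM2l ?exprn_ge0 ?(ltW (dyadic_weight_gt0 _))//.
rewrite rnorm_prod (bigD1 i0)//=; apply: ler_pM; rewrite ?rnorm_ge0//.
- by apply: prodr_ge0 => i _; exact: rnorm_ge0.
- by rewrite /walsh_factor i0B walsh_row_le.
by apply: ler_prod => i _; rewrite rnorm_ge0 walsh_factor_le.
Qed.

Lemma walsh_value_in x : walsh_value x \in in_ell p.
Proof. by rewrite unfold_in; apply: (le_lt_trans (walsh_value_bound x)); exact: ltry. Qed.

Definition walsh_operator (x : 'I_m -> l1) : ell s p1 := Ell p1 (walsh_value_in x).

Lemma walsh_operator_bounded : bounded_multilinear m l1 (ell s p1) walsh_operator.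
Proof.
split; last first.
  exists 1 => x; rewrite mul1r -lee_fin ell_rnormE; exact: walsh_value_bound.
move=> x i a u v; apply: val_inj; apply/funext => c.
transitivity (a * walsh_value (dfwith x i u) c + walsh_value (dfwith x i v) c : K); last by [].
transitivity (walsh_value (dfwith x i (a *: u + v)) c : K); first by [].
rewrite /walsh_value; case: (c == 0%N); first by rewrite mulr0 addr0.
have E w : \prod_j walsh_factor c j (dfwith x i w j) =
    walsh_factor c i w * \prod_(j | j != i) walsh_factor c j (x j).
  rewrite (bigD1 i)//= dfwithin; congr (_ * _).
  by apply: eq_bigr => j ji; rewrite dfwithout// eq_sym.
have L : walsh_factor c i (a *: u + v) = a * walsh_factor c i u + walsh_factor c i v.
  by rewrite /walsh_factor; case: ifP => _; rewrite ?walsh_row_linear ?ell_coordP.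
by rewrite !E L; ring.
Qed.

End WalshOperator.

(** * Failure of summability for small exponents *)

Section Optimality.
Context {R : realType} {s : scalar_kind}.
Local Notation K := (scalars R s).
Local Notation l1 := (ell s (lexx (1%E : \bar R))).

Lemma weakly_summable_of_bound (E : normedModType K) (x : nat -> E) (W : R) :
  (forall (phi : {linear E -> K^o}) N, @dual_unit_ball R s E phi ->
    \sum_(j < N) rnorm (phi (x j)) <= W) ->
  weakly_summable x.
Proof.
move=> xW; rewrite /weakly_summable/=; apply: (@le_lt_trans _ _ W%:E); last exact: ltry.
apply: ge_ereal_sup => _ [phi phi1 <-].
apply: lime_le; first by apply: is_cvg_nneseries => j _ _; rewrite lee_fin rnorm_ge0.
by apply: nearW => N; rewrite sumEFin lee_fin big_mkord; exact: xW.
Qed.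

Variable rho : R.
Hypothesis rho01 : 0 < rho < 1.

(** The factor 2^(- 3 k / 2) is the inverse of the bound in [walsh_l1_bound], and
    the powers of [rho] make the blocks summable. *)
Definition walsh_coef (k : nat) : R := rho ^+ k / Num.sqrt 2 ^+ (3 * k).

Definition walsh_seq (u : nat) : l1 :=
  if u == 0%N then 0 else
  \sum_(2 ^ block_of u <= a < 2 ^ (block_of u).+1)
    (of_real (walsh_coef (block_of u) * walsh (block_of u) u a) : K) *: unit_vector a.

Lemma walsh_coef_gt0 k : 0 < walsh_coef k.
Proof.
by case/andP: rho01 => r0 _; rewrite divr_gt0 ?exprn_gt0// sqrtr_gt0.
Qed.

Lemma walsh_row_seq u : (0 < u)%N ->
  walsh_row u (walsh_seq u) = of_real (walsh_coef (block_of u) * 2 ^+ block_of u).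
Proof.
move=> u0; set k := block_of u; have uk := block_ofP u0; rewrite -/k in uk.
rewrite /walsh_row -/k.
transitivity (\sum_(2 ^ k <= a < 2 ^ k.+1)
    of_real (walsh_coef k * (walsh k u a * walsh k u a)) : K).
  rewrite big_nat [RHS]big_nat; apply: eq_bigr => a ak.
  rewrite /walsh_seq gtn_eqF// -/k ell_coord_sum.
  rewrite (bigD1_seq a) ?iota_uniq ?mem_index_iota//= eqxx mulr1 big1 ?addr0.
    by rewrite -of_realM; congr of_real; ring.
  by move=> c ca; rewrite eq_sym (negbTE ca) mulr0.
rewrite -(big_morph (@of_real R s) (@of_realD R s) (@of_real0 R s)); congr of_real.
by rewrite -mulr_sumr walsh_orthogonal// eqxx.
Qed.

Lemma walsh_seq_weakly_summable : weakly_summable walsh_seq.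
Proof.
case/andP: rho01 => r0 r1.
apply: (@weakly_summable_of_bound _ _ (2 / (1 - rho))) => phi N phi1.
have phiZ (c : K) v : phi (c *: v) = c * phi v :> K.
  first [exact: linearZ_LR | exact: linearZ| exact: (linearZ_LR phi c v) | exact: (linearZZ phi)].
have ph0 u : 0 <= rnorm (phi (walsh_seq u)) by exact: rnorm_ge0.
apply: (@le_trans _ _ (\sum_(1 <= u < 2 ^ N) rnorm (phi (walsh_seq u)))).
  rewrite -(big_mkord xpredT (fun u => rnorm (phi (walsh_seq u)))).
  case: N => [|N]; first by rewrite !big_geq.
  rewrite big_ltn// {1}/walsh_seq eqxx raddf0 rnorm0 add0r.
  rewrite [leRHS](big_cat_nat (n := N.+1))//=; last by rewrite ltnW// ltn_expl.
  by rewrite lerDl sumr_ge0.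
rewrite sum_blocks.
apply: (@le_trans _ _ (\sum_(k < N) 2 * rho ^+ k)).
  apply: ler_sum => k _.
  pose y g a := real_coord g (phi (unit_vector a) : K).
  have y1 g a : `|y g a| <= 1.
    apply: (le_trans (coord_le_rnorm _ _)); apply: phi1; exact: rnorm_unit_vector.
  have seqE u : (2 ^ k <= u < 2 ^ k.+1)%N -> rnorm (phi (walsh_seq u)) <=
      \sum_(g : bool) walsh_coef k * `|\sum_(2 ^ k <= a < 2 ^ k.+1) walsh k u a * y g a|.
    move=> uk; have u0 : (0 < u)%N by case/andP: uk => h _; exact: leq_trans (expn_gt0 2 k) h.
    rewrite /walsh_seq gtn_eqF// (block_ofE uk) linear_sum.
    apply: (le_trans (rnorm_le_coord _)); apply: ler_sum => g _.
    rewrite -[X in _ <= X * _](gtr0_norm (walsh_coef_gt0 k)) -normrM mulr_sumr.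
    rewrite real_coord_sum.
    rewrite le_eqVlt; apply/orP; left; apply/eqP; congr (`|_|).
    by apply: eq_bigr => a _; rewrite phiZ real_coordZ mulrA.
  rewrite big_nat; apply: (le_trans (ler_sum _ seqE)); rewrite -big_nat.
  under eq_bigr do rewrite big_bool /=.
  rewrite big_split/= -!mulr_sumr.
  have c0 := walsh_coef_gt0 k.
  have := ler_wpM2l (ltW c0) (walsh_l1_bound k (y1 true)).
  have := ler_wpM2l (ltW c0) (walsh_l1_bound k (y1 false)).
  have -> : walsh_coef k * Num.sqrt 2 ^+ (3 * k) = rho ^+ k.
    by rewrite /walsh_coef divfK// expf_neq0// gt_eqF// sqrtr_gt0.
  lra.
rewrite -mulr_sumr ler_pM2l// -[leRHS]div1r ler_pdivlMr ?subr_gt0//.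
have := subrX1 rho N; have := exprn_ge0 N (ltW r0).
move=> h1 h2; have : (1 - rho) * (\sum_(i < N) rho ^+ i) = 1 - rho ^+ N.
  by rewrite -(opprB rho) mulNr -h2 opprB.
lra.
Qed.

Lemma first_vector_weakly_summable :
  weakly_summable (fun j : nat => if j == 0%N then unit_vector 0%N else 0 : l1).
Proof.
apply: (@weakly_summable_of_bound _ _ 1) => phi [|N] phi1; first by rewrite big_ord0.
rewrite big_ord_recl/= big1 ?addr0 => [|i _]; last by rewrite raddf0 rnorm0.
by apply: phi1; exact: rnorm_unit_vector.
Qed.

(** Let all the variables in [B] run through the same index [u] of the block [k]
    while the others stay at 0. By orthogonality the coordinate [u] of the value is
    the power [k] of [dyadic_weight p * (rho / sqrt 2) ^ |B|]; its power [r] is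
    2^(- k), and there are 2^k such indices, so every block contributes 1. *)
Lemma walsh_operator_not_summing (m : nat) (I : {set {set 'I_m}}) (B : {set 'I_m})
    (i0 : 'I_m) (i0B : i0 \in B) (p : \bar R) (p1 : (1 <= p)%E) (r : R) :
  finset.partition I [set: 'I_m]%SET -> B \in I -> 0 < r ->
  (dyadic_weight p * (rho / Num.sqrt 2) ^+ #|B|) `^ r = 2^-1 ->
  ~ partially_summing I r l1 (ell s p1) (walsh_operator i0B p1).
Proof.
move=> Ipart BI r_gt0 th [_ Tsum]; case/andP: rho01 => r0 r1.
pose x (i : 'I_m) : nat -> l1 := if i \in B then walsh_seq
  else fun j => if j == 0%N then unit_vector 0%N else 0.
have xw i : weakly_summable (x i).
  rewrite /x; case: ifP => _; [exact: walsh_seq_weakly_summable|].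
  exact: first_vector_weakly_summable.
have := Tsum x xw; set S := esum _ _ => Soo.
pose idx (u : nat) : {ffun 'I_m -> nat} := [ffun i => if i \in B then u else 0%N].
have idx_inj : injective idx.
  by move=> u v /(congr1 (fun j : {ffun 'I_m -> nat} => j i0)); rewrite !ffunE i0B.
have idxI u : diagonal_indices I (idx u).
  move=> L LI a c aL cL; rewrite !ffunE.
  have [_ /finset.trivIsetP tI _] := and3P Ipart.
  have [LB|LB] := eqVneq L B; first by rewrite -LB aL cL.
  have dis := tI L B LI BI LB.
  by rewrite (disjointFr dis aL) (disjointFr dis cL).
have term u : (0 < u)%N -> 2 ^- block_of u <=
    rnorm (walsh_operator i0B p1 (fun i => x i (idx u i))) `^ r.
  move=> u0; set k := block_of u; pose th0 := dyadic_weight p * (rho / Num.sqrt 2) ^+ #|B|.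
  have th00 : 0 < th0.
    by rewrite mulr_gt0 ?dyadic_weight_gt0// exprn_gt0// divr_gt0// sqrtr_gt0.
  have -> : 2 ^- k = (th0 ^+ k) `^ r.
    rewrite -powR_mulrn ?(ltW th00)// powRAC th powR_mulrn ?exprVn// invr_ge0//.
  apply: le_powR; rewrite ?(ltW r_gt0) ?exprn_ge0 ?(ltW th00)//.
  apply: le_trans (ell_coord_le _ u).
  rewrite /= /walsh_value gtn_eqF// rnormM rnorm_of_real -/k.
  rewrite ger0_norm ?exprn_ge0 ?(ltW (dyadic_weight_gt0 _))// rnorm_prod.
  rewrite (bigID (fun i => i \in B))/= [X in _ <= _ * (_ * X)]big1 ?mulr1; last first.
    move=> i /negbTE iB; rewrite /walsh_factor iB /x iB ffunE iB eqxx.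
    exact: rnorm_one.
  rewrite (eq_bigr (fun=> (rho / Num.sqrt 2) ^+ k)); last first.
    move=> i iB; rewrite /walsh_factor iB /x iB ffunE iB walsh_row_seq// -/k.
    rewrite rnorm_of_real ger0_norm ?(mulr_ge0 (ltW (walsh_coef_gt0 _))) ?exprn_ge0//.
    have b0 : Num.sqrt 2 != 0 :> R by rewrite gt_eqF// sqrtr_gt0.
    have -> : 2 ^+ k = Num.sqrt 2 ^+ (2 * k) :> R by rewrite exprM sqr_sqrtr.
    rewrite /walsh_coef expr_div_n (_ : 3 * k = 2 * k + k)%N; last by rewrite -mulSnr.
    by rewrite exprD; field; rewrite !expf_neq0.
  rewrite prodr_const /th0 exprMn -!exprM mulnC le_eqVlt; apply/orP; left; apply/eqP.
  by rewrite [(k * _)%N]mulnC.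
have big n : (n%:R%:E <= S)%E.
  apply: esum_ge; pose r_ := [seq idx u | u <- index_iota 1 (2 ^ n)].
  exists [set` r_].
    split; first exact: finite_seq.
    by move=> j /= /mapP[u _ ->]; exact: idxI.
  rewrite -fsbig_seq/=; last by rewrite map_inj_uniq// iota_uniq.
  rewrite big_map sumEFin lee_fin.
  apply: (@le_trans _ _ (\sum_(1 <= u < 2 ^ n) 2 ^- block_of u)); last first.
    rewrite big_nat [leRHS]big_nat; apply: ler_sum => u /andP[u0 _]; exact: term.
  rewrite sum_blocks.
  rewrite (eq_bigr (fun=> 1)); first by rewrite sumr_const card_ord.
  move=> k _; rewrite big_nat (eq_bigr (fun=> 2 ^- k)); last first.
    by move=> u uk; rewrite (block_ofE uk).
  rewrite -big_nat sumr_const_nat expnS mul2n -addnn addnK -[LHS]mulr_natl natrX.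
  by rewrite mulfV// expf_neq0.
have S0 : (0 <= S)%E by have := big 0%N.
have Sfin : S \is a fin_num by rewrite ge0_fin_numE.
have := big (Num.bound (fine S)); rewrite -(fineK Sfin) lee_fin leNgt.
by rewrite archi_boundP// fine_ge0.
Qed.

End Optimality.

(** * The main result *)

Section MainResult.
Context {R : realType} {s : scalar_kind}.
Local Notation K := (scalars R s).
Local Notation l1 := (ell s (lexx (1%E : \bar R))).

(** For [p = 2] the two formulas for the exponent coincide, so [interior_summing]
    may take the conjugate exponent only for [p < 2]. *)
Lemma bounded_partially_summing (m : nat) (I : {set {set 'I_m}}) (p : \bar R)
    (p1 : (1 <= p)%E) (T : ('I_m -> l1) -> ell s p1) :
  (0 < m)%N -> finset.partition I [set: 'I_m]%SET ->
  bounded_multilinear m l1 (ell s p1) T ->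
  partially_summing I (summing_exponent (min_block_card I) p) l1 (ell s p1) T.
Proof.
move=> m0 Ipart.
have n0 : (0 < min_block_card I)%N by exact: min_block_card_gt0.
case: p p1 T => [q| |] p1 T // Tb; last exact: endpoint_summing.
have q1 : 1 <= q by have := p1; rewrite lee_fin.
have [q_eq1|q_neq1] := eqVneq q 1.
  have -> : summing_exponent (min_block_card I) q%:E = 2 / (min_block_card I)%:R.
    rewrite /summing_exponent q_eq1 ler1n; congr (_ / _); lra.
  exact: endpoint_summing.
have lt1q : 1 < q by rewrite lt_def q_neq1.
have np : 0 < (min_block_card I)%:R :> R by rewrite ltr0n.
set n : R := (min_block_card I)%:R in np *.
have nq : 0 < n * q by rewrite mulr_gt0//; lra.
have tE : summing_exponent (min_block_card I) q%:E =
    if q < 2 then 2 * q / (n * q + 2 * q - 2) else 2 * q / (n * q + 2).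
  rewrite /summing_exponent -/n; have [q2|q2|->] := ltgtP q 2 => //.
  by congr (_ / _); ring.
apply: (@interior_summing R s m I q _ _ p1 T m0 Ipart lt1q erefl) => //; rewrite tE -/n.
  by case: ifP => q2; rewrite divr_gt0//; lra.
case: ifP => q2; field; rewrite ?gt_eqF//; lra.
Qed.

Lemma min_block_card_attained (m : nat) (I : {set {set 'I_m}}) (B0 : {set 'I_m}) :
  B0 \in I -> exists2 B, B \in I & #|B| = min_block_card I.
Proof.
move=> B0I; have [|//] : min_block_card I = m \/ exists2 B, B \in I & #|B| = min_block_card I.
  rewrite /min_block_card; elim/big_ind: _ => [|a b ha hb|B BI]; first by left.
  - by rewrite /minn; case: ifP.
  - by right; exists B.
move=> nm; exists B0 => //; apply/eqP; rewrite eqn_leq min_block_card_le// nm.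
by rewrite (leq_trans (max_card _))// card_ord.
Qed.

(** The number [ep] solves [1 / p + n (1 / 2 + ep) = 1 / r], which is the
    normalization in [walsh_operator_not_summing] for [rho = 2^(- ep)]; it is
    positive because [r < t]. *)
Lemma summing_exponent_optimal (m : nat) (I : {set {set 'I_m}}) (p : \bar R)
    (p1 : (1 <= p)%E) (r : R) :
  (0 < m)%N -> finset.partition I [set: 'I_m]%SET -> (2%:E <= p)%E ->
  0 < r < summing_exponent (min_block_card I) p ->
  exists2 T, bounded_multilinear m l1 (ell s p1) T & ~ partially_summing I r l1 (ell s p1) T.
Proof.
move=> m0 Ipart p2 /andP[r0 rt].
have n0 : (0 < min_block_card I)%N by exact: min_block_card_gt0.
have [B0 B0I] : exists B0, B0 \in I.
  have : Ordinal m0 \in finset.cover I by rewrite (finset.cover_partition Ipart) finset.in_setT.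
  by move=> /finset.bigcupP[B0 B0I _]; exists B0.
have [B BI Bn] := min_block_card_attained B0I.
have [i0 i0B] : exists i0, i0 \in B by apply/card_gt0P; rewrite Bn.
pose n : R := (min_block_card I)%:R.
have np : 0 < n by rewrite ltr0n.
pose iq : R := if p is q%:E then q^-1 else 0.
have wE : dyadic_weight p = 2 `^ (- iq).
  by rewrite /dyadic_weight /iq; case: (p) => [q| |] //; rewrite oppr0 powRr0.
have rn : n / 2 + iq < r^-1.
  rewrite -[ltLHS]invrK ltf_pV2 ?posrE//.
    apply: (lt_le_trans rt); rewrite le_eqVlt; apply/orP; left; apply/eqP.
    move: p2; rewrite /summing_exponent /iq; case: (p) => [q| |] //=.
      rewrite lee_fin -/n => q2; have nq : 0 < n * q by rewrite mulr_gt0//; lra.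
      have [ltq|gtq|q_eq] := ltgtP q 2; first by lra.
        by field; rewrite !gt_eqF//; lra.
      by rewrite q_eq; field; rewrite ?gt_eqF//; lra.
    by rewrite addr0 invf_div.
  rewrite invr_gt0 ltr_pwDl ?divr_gt0// /iq; move: p2; case: (p) => [q| |] //.
  by rewrite lee_fin invr_ge0 => q2; lra.
pose ep := (r^-1 - (n / 2 + iq)) / n.
have ep0 : 0 < ep by rewrite divr_gt0// subr_gt0.
pose rho := 2 `^ (- ep).
have rho01 : 0 < rho < 1.
  rewrite /rho powR_gt0//= powRN invf_lt1 ?powR_gt0//.
  by rewrite -[ltLHS](powRr0 2) /powR gt_eqF// ltr_expR mul0r mulr_gt0// ln_gt0// ltr1n.
exists (walsh_operator i0B p1); first exact: walsh_operator_bounded.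
apply: (@walsh_operator_not_summing R s rho rho01 m I B i0 i0B p p1 r Ipart BI r0).
have tn : 2 != 0 :> R by [].
have -> : Num.sqrt 2 = 2 `^ 2^-1 :> R by rewrite powR12_sqrt.
have two (a b : R) : 2 `^ a * 2 `^ b = 2 `^ (a + b) :> R.
  by rewrite powRD// tn implybT.
rewrite wE -powRN two -powR_mulrn ?powR_ge0// -powRrM Bn -/n two -powRrM -[RHS]powR_inv1//.
congr (_ `^ _); rewrite /ep; field.
by rewrite !gt_eqF.
Qed.

End MainResult.

Theorem theorem4p5 (R : realType) (s : scalar_kind) (m k : nat)
    (m_gt0 : (0 < m)%N) (k_bounds : (1 <= k <= m)%N)
    (I : {set {set 'I_m}}) (I_partition : finset.partition I [set: 'I_m]%SET)
    (I_card : #|I| = k) (p : \bar R) (p1 : (1 <= p)%E) :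
  let n := min_block_card I in
  let t := summing_exponent n p in
  let l1 : normedModType (scalars R s) := ell s (lexx 1%E) in
  let lp : normedModType (scalars R s) := ell s p1 in
  bounded_multilinear m l1 lp = partially_summing I t l1 lp
  /\ ((2%:E <= p)%E -> forall r : R, 0 < r < t ->
        bounded_multilinear m l1 lp <> partially_summing I r l1 lp).

Proof.
move=> n t l1 lp; split.
  by apply/seteqP; split=> T; [exact: bounded_partially_summing|case].
move=> p2 r rt EQ.
have [T Tb not_summing] :=
  @summing_exponent_optimal R s m I p p1 r m_gt0 I_partition p2 rt.
have sumT : partially_summing I r l1 lp T by rewrite -EQ.
exact: not_summing sumT.
Qed.
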